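(* Every $C^*$-algebra with a circle action is gauge invariantly isomorphic to an algebra of the form $\mathcal{DR}(\mathcal T)$ for some right tensor $C^*$-precategory $\mathcal T$ (and hence also to an algebra of the form $\mathcal O_{\mathcal T}(\mathcal K,\mathcal J)$ for some ideals $\mathcal K,\mathcal J$ in a right tensor $C^*$-precategory $\mathcal T$ with $\mathcal J\subset J(\mathcal K)$). That is, for every $C^*$-algebra $B$ with a circle action $\gamma:S^1\to\mathrm{Aut}\,B$ there is a $*$-isomorphism from $B$ onto such an algebra intertwining $\gamma$ with the gauge action.
   Context: $\mathbb N=\{0,1,2,\dots\}$. A circle action is a (point-norm continuous) homomorphism $\gamma:S^1\to\mathrm{Aut}\,B$. A $C^*$-precategory $\mathcal T$ with object set $\mathbb N$ consists of complex Banach spaces $\mathcal T(n,m)$, bilinear associative compositions $\mathcal T(n,m)\times\mathcal T(m,l)\to\mathcal T(n,l)$ with $\|ab\|\le\|a\|\|b\|$, and antilinear involutive maps $*:\mathcal T(n,m)\to\mathcal T(m,n)$ with $(ab)^*=b^*a^*$, $\|a^*a\|=\|a\|^2$ and $a^*a$ positive in the $C^*$-algebra $\mathcal T(m,m)$ for $a\in\mathcal T(n,m)$. An ideal in $\mathcal T$ is a family of closed subspaces $\mathcal K(n,m)\subset\mathcal T(n,m)$ stable under left and right composition with morphisms of $\mathcal T$. A right tensor $C^*$-precategory is such a $\mathcal T$ with linear maps $\otimes1:\mathcal T(n,m)\to\mathcal T(n+1,m+1)$ preserving composition and involution; $\otimes1^k$ is the $k$-th iterate. $J(\mathcal K)(n,m)=\{a\in\mathcal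 K(n,m):a\otimes1\in\mathcal K(n+1,m+1)\}$. $\mathcal{DR}(\mathcal T)$: for $k\in\mathbb Z$ let $\mathcal{DR}^{(k)}(\mathcal T)=\varinjlim_r\mathcal T(r+k,r)$ be the Banach space inductive limit along the maps $\otimes1$. $\bigoplus_k\mathcal{DR}^{(k)}(\mathcal T)$ is a $\mathbb Z$-graded $*$-algebra with operations induced by composition and involution, and $\mathcal{DR}(\mathcal T)$ is its completion in the unique $C^*$-norm for which the action of $S^1$ given by multiplication by $z^k$ on degree $k$ is isometric (it agrees with the limit norm on each $\mathcal{DR}^{(k)}(\mathcal T)$); this action is the gauge action. A right tensor representation of an ideal $\mathcal K$ in a $C^*$-algebra is a family of linear maps $\pi_{n,m}$ on $\mathcal K(n,m)$ with $\pi_{n,m}(a)^*=\pi_{m,n}(a^* )$, $\pi_{n,m}(a)\pi_{m+k,l}(b)=\pi_{n+k,l}((a\otimes1^k)b)$; it is coisometric on $\mathcal J$ if $\pi_{n,m}(a)=\pi_{n+1,m+1}(a\otimes1)$ for $a\in\mathcal J(n,m)$. $\mathcal O_{\mathcal T}(\mathcal K,\mathcal J)$ is the universal $C^*$-algebra generated by the image of a universal right tensor representation $\iota$ of $\mathcal K$ coisometric on $\mathcal J$, with gauge action $\gamma_z(\iota_{n,m}(a))=z^{n-m}\iota_{n,m}(a)$. *)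

(* Defs.v *)
From HB Require Import structures.
From mathcomp Require Import all_boot all_order all_algebra.
From mathcomp Require Import complex.
From mathcomp Require Import boolp classical_sets functions cardinality fsbigop.
From mathcomp Require Import reals topology normedtype sequences.

Set Implicit Arguments.
Unset Strict Implicit.
Unset Printing Implicit Defensive.

Import Order.TTheory GRing.Theory Num.Theory numFieldNormedType.Exports.
Local Open Scope classical_set_scope.
Local Open Scope ring_scope.

(** Norms of complex normed spaces take values in the nonnegative reals of
    R[i].  The topology of the scalar field is that of R[i]^o. *)

HB.mixin Record NormedModule_isCStarAlgebra (R : realType) A
    & CompleteNormedModule R[i] A := {
  cmul : A -> A -> A;
  cstar : A -> A;
  cmul_linearl : forall y, linear (cmul^~ y);
  cmul_linearr : forall x, linear (cmul x);
  cmulA : associative cmul;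
  cmul_norm : forall x y, `|cmul x y| <= `|x| * `|y|;
  cstar_antilinear : forall a x y, cstar (a *: x + y) = a^* *: cstar x + cstar y;
  cstarK : involutive cstar;
  cstarM : forall x y, cstar (cmul x y) = cmul (cstar y) (cstar x);
  cstar_norm : forall x, `|cmul (cstar x) x| = `|x| ^+ 2
}.

#[short(type="cstarAlgType")]
HB.structure Definition CStarAlgebra (R : realType) :=
  {A of CompleteNormedModule R[i] A & NormedModule_isCStarAlgebra R A}.

Section CStarAlgebras.
Context {R : realType}.
Implicit Types A B : cstarAlgType R.

Record star_hom A B (f : A -> B) : Prop := {
  star_hom_linear : linear f;
  star_homM : forall x y, f (cmul x y) = cmul (f x) (f y);
  star_homS : forall x, f (cstar x) = cstar (f x) }.

Definition star_iso A B (f : A -> B) : Prop := star_hom f /\ bijective f.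

Record star_subalgebra A (S : set A) : Prop := {
  star_subalgebra0 : S 0;
  star_subalgebraD : forall (a : R[i]) x y, S x -> S y -> S (a *: x + y);
  star_subalgebraM : forall x y, S x -> S y -> S (cmul x y);
  star_subalgebraS : forall x, S x -> S (cstar x) }.

Definition generates A (X : set A) : Prop :=
  forall S : set A, star_subalgebra S -> closed S -> X `<=` S -> S = setT.

Definition circle : set R[i]^o := [set z | `|z| = 1].

(** [g] is a total function on the scalars, but only its restriction to the
    circle matters. [g 1 = id] follows from [g 1] being injective. *)
Record circle_action A (g : R[i] -> A -> A) : Prop := {
  circle_action_aut : forall z : R[i], circle z -> star_iso (g z);
  circle_actionM : forall z w : R[i], circle z -> circle w ->
    forall x, g (z * w) x = g z (g w x);
  circle_action_cts : forall x, {within circle, continuous (fun z => g z x)} }.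

Definition equivariant_iso A B (g : R[i] -> A -> A) (h : R[i] -> B -> B)
    (f : A -> B) : Prop :=
  star_iso f /\ forall z : R[i], circle z -> forall x, f (g z x) = h z (f x).

End CStarAlgebras.

(** A morphism [a : T n m] is composed with [b : T m l] as
    [pcomp a b : T n l].  Positivity in the C*-algebra [T m m] means being of
    the form [c^* c] with [c] in [T m m]. *)
Record cstar_precat (R : realType) := CStarPrecat {
  phom :> nat -> nat -> completeNormedModType R[i];
  pcomp : forall n m l, phom n m -> phom m l -> phom n l;
  pstar : forall n m, phom n m -> phom m n;
  pcomp_linearl : forall n m l (b : phom m l),
    linear (fun a : phom n m => pcomp a b);
  pcomp_linearr : forall n m l (a : phom n m),
    linear (fun b : phom m l => pcomp a b);
  pcompA : forall n m l p (a : phom n m) (b : phom m l) (c : phom l p),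
    pcomp a (pcomp b c) = pcomp (pcomp a b) c;
  pcomp_norm : forall n m l (a : phom n m) (b : phom m l),
    `|pcomp a b| <= `|a| * `|b|;
  pstar_antilinear : forall n m (t : R[i]) (a b : phom n m),
    pstar (t *: a + b) = t^* *: pstar a + pstar b;
  pstarK : forall n m (a : phom n m), pstar (pstar a) = a;
  pstarM : forall n m l (a : phom n m) (b : phom m l),
    pstar (pcomp a b) = pcomp (pstar b) (pstar a);
  pstar_norm : forall n m (a : phom n m), `|pcomp (pstar a) a| = `|a| ^+ 2;
  pstar_pos : forall n m (a : phom n m),
    exists c : phom m m, pcomp (pstar a) a = pcomp (pstar c) c }.

(** [tens a] is the morphism written a (x) 1. *)
Record tensor_precat (R : realType) := TensorPrecat {
  tprecat :> cstar_precat R;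
  tens : forall n m, tprecat n m -> tprecat n.+1 m.+1;
  tens_linear : forall n m, linear (@tens n m);
  tens_comp : forall n m l (a : tprecat n m) (b : tprecat m l),
    tens (pcomp a b) = pcomp (tens a) (tens b);
  tens_star : forall n m (a : tprecat n m), tens (pstar a) = pstar (tens a) }.

Section TensorPrecategories.
Context {R : realType}.
Implicit Types T : tensor_precat R.

Fixpoint tensn T (k n m : nat) (a : T n m) : T (k + n)%N (k + m)%N :=
  if k is k'.+1 then tens (tensn k' a) else a.

Record is_ideal T (K : forall n m, set (T n m)) : Prop := {
  ideal_closed : forall n m, closed (K n m);
  ideal0 : forall n m, K n m 0;
  idealD : forall n m (t : R[i]) (a b : T n m),
    K n m a -> K n m b -> K n m (t *: a + b);
  ideal_compl : forall n m l (a : T n m) (b : T m l),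
    K m l b -> K n l (pcomp a b);
  ideal_compr : forall n m l (a : T n m) (b : T m l),
    K n m a -> K n l (pcomp a b) }.

Definition Jideal T (K : forall n m, set (T n m)) n m : set (T n m) :=
  [set a | K n m a /\ K n.+1 m.+1 (tens a)].

(** [E] is the Banach space inductive limit DR^(k) of the spaces
    [T (r + k) r] along the maps [tens], with structure maps [theta]: it is
    the completion of the algebraic limit for the limit seminorm.  The index
    [r] is replaced by the pair [(n, m) = (r + k, r)], which covers negative
    [k] as well. *)
Record is_DR_degree T (k : int) (E : completeNormedModType R[i])
    (theta : forall n m : nat, n%:Z = m%:Z + k -> T n m -> E) : Prop := {
  DR_degree_linear : forall n m e, linear (@theta n m e);
  DR_degree_tens : forall n m e e' (a : T n m),
    @theta n.+1 m.+1 e' (tens a) = @theta n m e a;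
  DR_degree_norm : forall n m e (a : T n m),
    (fun s => `|tensn s a| : R[i]^o) @ \oo --> (`|@theta n m e a| : R[i]^o);
  DR_degree_dense :
    closure [set x | exists n m e (a : T n m), x = @theta n m e a] = setT }.

(** The Z-graded *-algebra whose degree [k] part is DR^(k). Its operations are
    the continuous extensions of composition and involution; the degree
    equations are arguments so as to avoid transports. *)
Record DR_graded T := DRGraded {
  DRdeg :> int -> completeNormedModType R[i];
  DRin : forall k n m, n%:Z = m%:Z + k -> T n m -> DRdeg k;
  DRmul : forall k l p, p = k + l -> DRdeg k -> DRdeg l -> DRdeg p;
  DRstar : forall k p, p = - k -> DRdeg k -> DRdeg p;
  DRdegP : forall k, is_DR_degree (@DRin k);
  DRmul_linearl : forall k l p (e : p = k + l) y, linear ((DRmul e)^~ y);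
  DRmul_linearr : forall k l p (e : p = k + l) x, linear (DRmul e x);
  DRmul_norm : forall k l p (e : p = k + l) x y,
    `|DRmul e x y| <= `|x| * `|y|;
  DRmul_comp : forall k l p (e : p = k + l) n m q e1 e2 e3
      (a : T n m) (b : T m q),
    DRmul e (@DRin k n m e1 a) (@DRin l m q e2 b) = @DRin p n q e3 (pcomp a b);
  DRstar_antilinear : forall k p (e : p = - k) (t : R[i]) x y,
    DRstar e (t *: x + y) = t^* *: DRstar e x + DRstar e y;
  DRstar_norm : forall k p (e : p = - k) x, `|DRstar e x| = `|x|;
  DRstar_star : forall k p (e : p = - k) n m e1 e2 (a : T n m),
    DRstar e (@DRin k n m e1 a) = @DRin p m n e2 (pstar a) }.

(** A family [x] with [finsupp x] is an element of the algebraic direct sum of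
    the DR^(k). *)
Definition finsupp T (G : DR_graded T) (x : forall k, G k) : Prop :=
  finite_set [set k | x k != 0].

Definition DRsum T (G : DR_graded T) (D : cstarAlgType R)
    (j : forall k, G k -> D) (x : forall k, G k) : D :=
  \sum_(k \in [set: int]) j k (x k).

(** [D] with the action [g] is the completion of the direct sum of the [G k]
    for a C*-norm for which the gauge action [g] is isometric, [j k] being the
    inclusion of the degree [k] part. *)
Record is_DR_completion T (G : DR_graded T) (D : cstarAlgType R)
    (g : R[i] -> D -> D) (j : forall k, G k -> D) : Prop := {
  DRcomp_linear : forall k, linear (@j k);
  DRcomp_mul : forall k l p (e : p = k + l) x y,
    j p (DRmul e x y) = cmul (j k x) (j l y);
  DRcomp_star : forall k p (e : p = - k) x, j p (DRstar e x) = cstar (j k x);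
  DRcomp_inj : forall x, finsupp x -> DRsum j x = 0 -> forall k, x k = 0;
  DRcomp_dense :
    closure [set y | exists x, finsupp x /\ y = DRsum j x] = setT;
  DRcomp_norm : forall k x, `|j k x| = `|x|;
  DRcomp_action : circle_action g;
  DRcomp_isometric : forall z : R[i], circle z -> forall y, `|g z y| = `|y|;
  DRcomp_gauge : forall z : R[i], circle z -> forall k x, g z (j k x) = z ^ k *: j k x
}.

Definition is_DR T (D : cstarAlgType R) (g : R[i] -> D -> D) : Prop :=
  exists (G : DR_graded T) (j : forall k, G k -> D), is_DR_completion g j.

(** The maps [pi n m] are total, but only their values on [K n m] matter. *)
Record is_tensor_rep T (K : forall n m, set (T n m)) (A : cstarAlgType R)
    (pi : forall n m, T n m -> A) : Prop := {
  rep_linear : forall n m (t : R[i]) (a b : T n m), K n m a -> K n m b ->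
    pi n m (t *: a + b) = t *: pi n m a + pi n m b;
  rep_star : forall n m (a : T n m), K n m a ->
    pi m n (pstar a) = cstar (pi n m a);
  rep_mul : forall n m k l (a : T n m) (b : T (k + m)%N l),
    K n m a -> K (k + m)%N l b ->
    cmul (pi n m a) (pi (k + m)%N l b) =
    pi (k + n)%N l (pcomp (tensn k a) b) }.

Definition coisometric T (J : forall n m, set (T n m)) (A : cstarAlgType R)
    (pi : forall n m, T n m -> A) : Prop :=
  forall n m (a : T n m), J n m a -> pi n m a = pi n.+1 m.+1 (tens a).

Record is_universal_rep T (K J : forall n m, set (T n m)) (O : cstarAlgType R)
    (iota : forall n m, T n m -> O) : Prop := {
  universal_rep : is_tensor_rep K iota;
  universal_coisometric : coisometric J iota;
  universal_generates :
    generates [set x | exists n m (a : T n m), K n m a /\ x = iota n m a];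
  universal_factor : forall (A : cstarAlgType R) (pi : forall n m, T n m -> A),
    is_tensor_rep K pi -> coisometric J pi ->
    exists psi : O -> A, star_hom psi /\
      forall n m (a : T n m), K n m a -> psi (iota n m a) = pi n m a }.

Definition is_OTKJ T (K J : forall n m, set (T n m)) (O : cstarAlgType R)
    (g : R[i] -> O -> O) : Prop :=
  exists iota : forall n m, T n m -> O,
    [/\ is_universal_rep K J iota,
        circle_action g &
        forall z : R[i], circle z -> forall n m (a : T n m), K n m a ->
          g z (iota n m a) = z ^ (n%:Z - m%:Z) *: iota n m a].

End TensorPrecategories.

Arguments Jideal {R T} K n m _.

(* Main.v *)
(* The precategory with [T n m] the spectral subspace of degree [n - m] and
   [- (x) 1] the identity has [B] itself as its Doplicher-Roberts algebra, since
   Fejer's theorem makes the span of the spectral subspaces dense.  That [a^* a]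
   is positive in the fixed point algebra follows from Kelley and Vaught's
   description of positive elements, and the circle acts by isometries because
   *-homomorphisms are contractive.

   With [K] and [J] equal to [T], the same algebra is universal: a
   representation of [T] contracts each spectral subspace, hence increases the
   norm of a sum with degrees in [[-N, N]] by a factor of at most [2 N + 1]; the
   C*-identity applied to the powers of the sum removes this factor. *)
Require Import Defs.
From HB Require Import structures.
From mathcomp Require Import all_boot all_order all_algebra.
From mathcomp Require Import complex.
From mathcomp Require Import boolp classical_sets functions cardinality fsbigop.
From mathcomp Require Import reals topology normedtype sequences trigo.
From mathcomp Require Import ring lra zify.

Set Implicit Arguments.
Unset Strict Implicit.
Unset Printing Implicit Defensive.

Import Order.TTheory GRing.Theory Num.Theory numFieldNormedType.Exports.
Local Open Scope classical_set_scope.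
Local Open Scope complex_scope.
Local Open Scope ring_scope.

(** [B] need not have a unit, so whatever would be said of 1 - h or t - p is said of the operators b
    -> b - h b and b -> t b - p b. Nothing is lost, because the norm of x is the norm of left
    multiplication by x. Square roots are built as limits of polynomials without constant term in
    the given element; hence they lie in every closed *-subalgebra containing it. This keeps the
    root of a^* a in the fixed point algebra, and makes roots commute with every selfadjoint element
    commuting with the radicand.

    The projection onto degree k, classically the integral of z^(-k) g_z x over the circle, is the
    limit of means over the roots of unity of order 2^n. Orthogonality of characters and the mass of
    the Fejer kernel become identities between finite sums, and the only analytic input on the
    action is its continuity at z = 1. *)

Local Notation "x ** y" := (cmul x y) (at level 40, left associativity).
#[local] Obligation Tactic := idtac.

(* Decides identities between sums of atoms in an abelian group. *)
Inductive zmod_expr := ZVar of nat | ZAdd of zmod_expr & zmod_expr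
  | ZOpp of zmod_expr | ZZero.

Fixpoint zmod_eval (V : zmodType) (env : seq V) (e : zmod_expr) : V :=
  match e with
  | ZVar i => nth 0 env i
  | ZAdd e1 e2 => zmod_eval env e1 + zmod_eval env e2
  | ZOpp e1 => - zmod_eval env e1
  | ZZero => 0
  end.

Fixpoint zmod_coef (e : zmod_expr) (i : nat) : int :=
  match e with
  | ZVar j => (i == j)%:Z
  | ZAdd e1 e2 => zmod_coef e1 i + zmod_coef e2 i
  | ZOpp e1 => - zmod_coef e1 i
  | ZZero => 0
  end.

Lemma zmod_evalE (V : zmodType) (env : seq V) e :
  zmod_eval env e = \sum_(i < size env) env`_i *~ zmod_coef e i.
Proof.
elim: e => [j|e1 IH1 e2 IH2|e IH|] /=.
- have [js|js] := ltnP j (size env); last first.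
    rewrite nth_default// big1// => i _.
    by rewrite (ltn_eqF (leq_trans (ltn_ord i) js)) mulr0z.
  rewrite (bigD1 (Ordinal js))//= eqxx mulr1z big1 ?addr0// => i ij.
  by move: ij; rewrite -val_eqE/= => /negbTE ->; rewrite mulr0z.
- by rewrite IH1 IH2 -big_split/=; apply: eq_bigr => i _; rewrite mulrzDr.
- by rewrite IH -sumrN; apply: eq_bigr => i _; rewrite mulrNz.
- by rewrite big1// => i _; rewrite mulr0z.
Qed.

Lemma zmod_eval_eq (V : zmodType) (env : seq V) n e1 e2 : size env = n ->
  all (fun i => zmod_coef e1 i == zmod_coef e2 i) (iota 0 n) ->
  zmod_eval env e1 = zmod_eval env e2.
Proof.
move=> <- /allP e12; rewrite !zmod_evalE; apply: eq_bigr => i _.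
by rewrite (eqP (e12 _ _))// mem_iota/= add0n.
Qed.

(* Scalars are compared up to conversion, as their types may be reached
   through different structures. *)
Ltac zmod_same x y :=
  first [constr_eq x y |
    match x with (?c *: ?v)%R => match y with (?d *: ?w)%R =>
      constr_eq v w; unify c d end end].

Ltac zmod_index x l :=
  match l with
  | ?y :: _ => let _ := match goal with _ => zmod_same x y end in constr:(O)
  | _ :: ?l' => let n := zmod_index x l' in constr:(S n)
  end.

Ltac zmod_atoms t l :=
  match t with
  | (?a + ?b)%R => let l' := zmod_atoms a l in zmod_atoms b l'
  | (- ?a)%R => zmod_atoms a l
  | 0%R => l
  | _ => match l with
         | _ => let n := zmod_index t l in l
         | _ => constr:(t :: l)
         end
  end.

Ltac zmod_reify t l :=
  match t with
  | (?a + ?b)%R => let a' := zmod_reify a l in let b' := zmod_reify b l in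
                   constr:(ZAdd a' b')
  | (- ?a)%R => let a' := zmod_reify a l in constr:(ZOpp a')
  | 0%R => constr:(ZZero)
  | _ => let n := zmod_index t l in constr:(ZVar n)
  end.

Ltac abel :=
  match goal with
  | |- @eq ?V ?x ?y =>
    let l := zmod_atoms x (@nil V) in let l := zmod_atoms y l in
    let e1 := zmod_reify x l in let e2 := zmod_reify y l in
    exact: (@zmod_eval_eq _ l _ e1 e2 erefl isT)
  end.

(** * Real-valued norms and sequential limits *)

Section RealNorm.
Context {R : realType}.
Implicit Types V W : normedModType R[i].

Lemma real_complex_inj (s t : R) : s%:C = t%:C -> s = t.
Proof. by case. Qed.

(** Norms take values in R[i], whose order is only partial; the real part ([cabs] for scalars, [nrm]
    for vectors) determines the norm and is accessible to real arithmetic. *)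
Definition cabs (a : R[i]) : R := complex.Re `|a|.

Lemma cabsE a : `|a| = (cabs a)%:C.
Proof. by rewrite /cabs RRe_real// ger0_real. Qed.

Lemma cabs_ge0 a : 0 <= cabs a.
Proof. by rewrite -ler0c -cabsE. Qed.

Lemma cabsM a b : cabs (a * b) = cabs a * cabs b.
Proof. by apply: real_complex_inj; rewrite rmorphM/= -!cabsE normrM. Qed.

Lemma cabsD a b : cabs (a + b) <= cabs a + cabs b.
Proof. by rewrite -lecR rmorphD/= -!cabsE ler_normD. Qed.

Lemma cabs_real (t : R) : 0 <= t -> cabs t%:C = t.
Proof. by move=> t0; rewrite /cabs ger0_norm// ler0c. Qed.

Lemma cabs_sqr a : cabs a ^+ 2 = complex.Re a ^+ 2 + complex.Im a ^+ 2.
Proof. by apply: real_complex_inj; rewrite rmorphXn/= -cabsE add_Re2_Im2. Qed.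

Definition nrm V (x : V) : R := complex.Re `|x|.

Lemma nrmE V (x : V) : `|x| = (nrm x)%:C.
Proof. by rewrite /nrm RRe_real// ger0_real. Qed.

Lemma nrm_ge0 V (x : V) : 0 <= nrm x.
Proof. by rewrite -ler0c -nrmE. Qed.

Lemma nrm0 V : nrm (0 : V) = 0.
Proof. by rewrite /nrm normr0. Qed.

Lemma nrm_eq0 V (x : V) : nrm x = 0 -> x = 0.
Proof. by move=> x0; apply/eqP; rewrite -normr_eq0 nrmE x0. Qed.

Lemma nrmN V (x : V) : nrm (- x) = nrm x.
Proof. by rewrite /nrm normrN. Qed.

Lemma nrmD V (x y : V) : nrm (x + y) <= nrm x + nrm y.
Proof. by rewrite -lecR rmorphD/= -!nrmE ler_normD. Qed.

Lemma nrmB V (x y : V) : nrm (x - y) <= nrm x + nrm y.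
Proof. by rewrite (le_trans (nrmD _ _))// nrmN. Qed.

Lemma nrm_distC V (x y : V) : nrm (x - y) = nrm (y - x).
Proof. by rewrite -nrmN opprB. Qed.

Lemma nrm_dist V (x y z : V) : nrm (x - z) <= nrm (x - y) + nrm (y - z).
Proof. by rewrite (le_trans _ (nrmD _ _))// addrA subrK. Qed.

Lemma nrmZ V a (x : V) : nrm (a *: x) = cabs a * nrm x.
Proof. by apply: real_complex_inj; rewrite rmorphM/= -nrmE normrZ nrmE cabsE. Qed.

Lemma nrmZr V (t : R) (x : V) : 0 <= t -> nrm (t%:C *: x) = t * nrm x.
Proof. by move=> t0; rewrite nrmZ cabs_real. Qed.

Lemma nrm_sum V I (s : seq I) (F : I -> V) :
  nrm (\sum_(i <- s) F i) <= \sum_(i <- s) nrm (F i).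
Proof.
elim/big_ind2 : _ => [|u a v b ua vb|//]; first by rewrite nrm0.
by rewrite (le_trans (nrmD _ _))// lerD.
Qed.

Lemma nrm_small V (x : V) : (forall e, 0 < e -> nrm x <= e) -> x = 0.
Proof.
move=> xe; apply: nrm_eq0; apply/eqP; rewrite eq_le nrm_ge0 andbT.
by apply/ler_addgt0Pl => e e0; rewrite addr0 xe.
Qed.

Lemma cvg_nrmP V (u : nat -> V) (l : V) :
  u @ \oo --> l <->
  forall e : R, 0 < e -> exists N, forall n, (N <= n)%N -> nrm (u n - l) <= e.
Proof.
split=> [/cvgrPdist_le ul e e0|ul].
  have [|N _ uN] := ul e%:C; first by rewrite ltcR.
  exists N => n /uN; rewrite -lecR -nrmE /=.
  by rewrite distrC.
apply/cvgrPdist_le => e e0.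
have eE : e = (complex.Re e)%:C by rewrite RRe_real// gtr0_real.
have [|N uN] := ul (complex.Re e); first by rewrite -ltcR -eE.
exists N => // n /= /uN; rewrite -lecR -nrmE -eE.
by rewrite distrC.
Qed.

Lemma cauchy_nrm_cvg (V : completeNormedModType R[i]) (u : nat -> V) :
  (forall e : R, 0 < e ->
    exists N, forall n, (N <= n)%N -> nrm (u n - u N) <= e) ->
  exists l : V, u @ \oo --> l.
Proof.
move=> uC; apply/cvg_ex/cauchy_cvgP/cauchy_exP => e e0.
have eE : e = (complex.Re e)%:C by rewrite RRe_real// gtr0_real.
have [|N uN] := uC (complex.Re e / 2); first by rewrite divr_gt0// -ltcR -eE.
exists (u N); exists N => // n /= /uN uNn.
rewrite -ball_normE /ball_/= distrC nrmE eE ltcR (le_lt_trans uNn)//.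
by rewrite ltr_pdivrMr// ltr_pMr ?ltr1n// -ltcR -eE.
Qed.

Lemma cvg_lip V W (f : V -> W) (C : R) (u : nat -> V) l :
  (forall x y, nrm (f x - f y) <= C * nrm (x - y)) ->
  u @ \oo --> l -> (fun n => f (u n)) @ \oo --> f l.
Proof.
move=> fC /cvg_nrmP ul; apply/cvg_nrmP => e e0.
have C1 : 0 < `|C| + 1 by rewrite ltr_wpDl.
have [|N uN] := ul (e / (`|C| + 1)); first by rewrite divr_gt0.
exists N => n /uN; rewrite ler_pdivlMr// mulrC; apply: le_trans.
rewrite (le_trans (fC _ _))// ler_wpM2r ?nrm_ge0//.
by rewrite (le_trans (ler_norm C))// lerDl.
Qed.

Lemma cvg_nrm_le V (u : nat -> V) l (C : R) :
  u @ \oo --> l -> (exists M, forall n, (M <= n)%N -> nrm (u n) <= C) ->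
  nrm l <= C.
Proof.
move=> /cvg_nrmP ul [M uC]; apply/ler_addgt0Pl => e e0.
have [N uN] := ul e e0; pose n := maxn M N.
rewrite -[l](subKr (u n)) (le_trans (nrmB _ _))// addrC lerD//.
  by rewrite uN// leq_maxr.
by rewrite uC// leq_maxl.
Qed.

Lemma cvg_uniq V (u : nat -> V) (l l' : V) :
  u @ \oo --> l -> u @ \oo --> l' -> l = l'.
Proof. exact: cvg_unique. Qed.

Lemma cvg_sum V I (s : seq I) (u : I -> nat -> V) (l : I -> V) :
  (forall i, u i @ \oo --> l i) ->
  (fun n => \sum_(i <- s) u i n) @ \oo --> \sum_(i <- s) l i.
Proof.
move=> ul; elim: s => [|i s IH].
  by rewrite big_nil; under eq_fun do rewrite big_nil; exact: cvg_cst.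
rewrite big_cons; under eq_fun do rewrite big_cons.
exact: cvgD.
Qed.

Lemma closed_seq V (S : set V) (u : nat -> V) l :
  closed S -> (forall n, S (u n)) -> u @ \oo --> l -> S l.
Proof. by move=> Sc Su; apply: closed_cvg => //; apply: nearW. Qed.

Lemma closure_nrmP V (S : set V) (x : V) :
  closure S x <-> forall e : R, 0 < e -> exists2 y, S y & nrm (x - y) <= e.
Proof.
split=> [Sx e e0|Sx B].
  have [|y [Sy]] := Sx (ball x e%:C); first by apply: nbhsx_ballx; rewrite ltcR.
  rewrite -ball_normE /ball_/= nrmE ltcR => /ltW xy; by exists y.
move=> /nbhs_ballP[e /= e0 xB].
have eE : e = (complex.Re e)%:C by rewrite RRe_real// gtr0_real.
have [|y Sy xy] := Sx (complex.Re e / 2); first by rewrite divr_gt0// -ltcR -eE.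
exists y; split=> //; apply: xB.
rewrite -ball_normE /ball_/= nrmE eE ltcR (le_lt_trans xy)//.
by rewrite ltr_pdivrMr// ltr_pMr ?ltr1n// -ltcR -eE.
Qed.

Lemma closed_nrm V (S : set V) :
  (forall x, (forall e : R, 0 < e -> exists2 y, S y & nrm (x - y) <= e) -> S x) ->
  closed S.
Proof. by move=> Sc x /closure_nrmP; exact: Sc. Qed.

End RealNorm.

(** * Elementary rules of calculation in a C*-algebra *)

Section CStarBasics.
Context {R : realType} {A : cstarAlgType R}.
Implicit Types x y z b : A.


Lemma cmulDl x y z : (x + y) ** z = x ** z + y ** z.
Proof. by have := cmul_linearl z 1 x y; rewrite !scale1r. Qed.
Lemma cmulDr x y z : z ** (x + y) = z ** x + z ** y.
Proof. by have := cmul_linearr z 1 x y; rewrite !scale1r. Qed.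
Lemma cmul0l x : 0 ** x = 0.
Proof.
have := cmulDl 0 0 x;
rewrite addr0 => /eqP.
by rewrite -subr_eq0 opprD addNKr oppr_eq0 => /eqP.
Qed.
Lemma cmul0r x : x ** 0 = 0.
Proof.
have := cmulDr 0 0 x;
rewrite addr0 => /eqP.
by rewrite -subr_eq0 opprD addNKr oppr_eq0 => /eqP.
Qed.
Lemma cmulZl a x y : (a *: x) ** y = a *: (x ** y).
Proof. by have := cmul_linearl y a x 0; rewrite /= !addr0 cmul0l addr0. Qed.
Lemma cmulZr a x y : x ** (a *: y) = a *: (x ** y).
Proof. by have := cmul_linearr x a y 0; rewrite !addr0 cmul0r addr0. Qed.
Lemma cmulNl x y : (- x) ** y = - (x ** y).
Proof. by rewrite -scaleN1r cmulZl scaleN1r. Qed.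
Lemma cmulNr x y : x ** (- y) = - (x ** y).
Proof. by rewrite -scaleN1r cmulZr scaleN1r. Qed.
Lemma cmulBl x y z : (x - y) ** z = x ** z - y ** z.
Proof. by rewrite cmulDl cmulNl. Qed.
Lemma cmulBr x y z : z ** (x - y) = z ** x - z ** y.
Proof. by rewrite cmulDr cmulNr. Qed.

Lemma cstarD x y : cstar (x + y) = cstar x + cstar y.
Proof. by have := cstar_antilinear 1 x y; rewrite rmorph1 !scale1r. Qed.
Lemma cstar0 : cstar (0 : A) = 0.
Proof.
have := cstarD 0 0;
rewrite addr0 => /eqP.
by rewrite -subr_eq0 opprD addNKr oppr_eq0 => /eqP.
Qed.
Lemma cstarZ a x : cstar (a *: x) = a^* *: cstar x.
Proof. by have := cstar_antilinear a x 0; rewrite !addr0 cstar0 addr0. Qed.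
Lemma cstarN x : cstar (- x) = - cstar x.
Proof. by rewrite -scaleN1r cstarZ rmorphN rmorph1 scaleN1r. Qed.
Lemma cstarB x y : cstar (x - y) = cstar x - cstar y.
Proof. by rewrite cstarD cstarN. Qed.
Lemma cstarZr (t : R) x : cstar (t%:C *: x) = t%:C *: cstar x.
Proof. by rewrite cstarZ conj_Creal//; apply/complex_realP; exists t. Qed.

Lemma nrmM x y : nrm (x ** y) <= nrm x * nrm y.
Proof. by rewrite -lecR rmorphM/= -!nrmE cmul_norm. Qed.

Lemma nrm_star_sqr x : nrm (cstar x ** x) = nrm x ^+ 2.
Proof. by apply: real_complex_inj; rewrite rmorphXn/= -!nrmE cstar_norm. Qed.

Lemma nrm_star_le x : nrm x <= nrm (cstar x).
Proof.
have := nrmM (cstar x) x; rewrite nrm_star_sqr expr2.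
have := nrm_ge0 x; rewrite le_eqVlt => /predU1P[<- _|x0]; first exact: nrm_ge0.
by rewrite ler_pM2r.
Qed.

Lemma nrm_star x : nrm (cstar x) = nrm x.
Proof. by apply/le_anti; rewrite nrm_star_le -{2}[x]cstarK nrm_star_le. Qed.

Lemma nrm_selfadj_sqr x : cstar x = x -> nrm (x ** x) = nrm x ^+ 2.
Proof. by move=> xx; rewrite -nrm_star_sqr xx. Qed.

Lemma cvg_cmulr x (u : nat -> A) l :
  u @ \oo --> l -> (fun n => u n ** x) @ \oo --> l ** x.
Proof. apply: (cvg_lip (f := fun y => y ** x) (C := nrm x)) => y z.
by rewrite -cmulBl mulrC nrmM. Qed.
Lemma cvg_cstar (u : nat -> A) l :
  u @ \oo --> l -> (fun n => cstar (u n)) @ \oo --> cstar l.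
Proof. by apply: (cvg_lip (C := 1)) => y z; rewrite -cstarB nrm_star mul1r. Qed.

Lemma cvg_bounded_nrm (u : nat -> A) (l : A) : u @ \oo --> l ->
  exists2 M : R, 0 <= M & exists N, forall n, (N <= n)%N -> nrm (u n) <= M.
Proof.
move=> /cvg_nrmP ul; have [N uN] := ul 1 ltr01.
exists (1 + nrm l); first by rewrite addr_ge0// nrm_ge0.
by exists N => n /uN ?; rewrite -[u n](subrK l) (le_trans (nrmD _ _))// lerD.
Qed.

Lemma cvg_cmul (u v : nat -> A) l m :
  u @ \oo --> l -> v @ \oo --> m -> (fun n => u n ** v n) @ \oo --> l ** m.
Proof.
move=> ul vm; have [M M0 [N0 uM]] := cvg_bounded_nrm ul.
have /cvg_nrmP ulm := cvg_cmulr (x := m) ul.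
apply/cvg_nrmP => e e0.
have M1 : 0 < M + 1 by rewrite ltr_wpDl.
have [|N1 h1] := ulm (e / 2); first by rewrite divr_gt0.
have /cvg_nrmP/(_ (e / 2 / (M + 1)))[|N2 h2] := vm; first by rewrite !divr_gt0.
exists (maxn N0 (maxn N1 N2)) => n; rewrite !geq_max => /and3P[n0 n1 n2].
rewrite (le_trans (nrm_dist _ (u n ** m) _))// [e]splitr lerD ?h1//.
rewrite -cmulBr (le_trans (nrmM _ _))//.
rewrite (le_trans (ler_pM _ _ (uM n n0) (h2 n n2))) ?nrm_ge0//.
rewrite [_ * (_ / _)]mulrCA ler_piMr ?divr_ge0// ?ltW//.
by rewrite ltr_pdivrMr// mul1r ltrDl.
Qed.

End CStarBasics.

(** * Square roots and contractivity of *-homomorphisms *)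

Section Sqrt.
Context {R : realType} {A : cstarAlgType R}.
Implicit Types x y z b c h k p : A.

Lemma star_subalgebraZ (S : set A) : star_subalgebra S ->
  forall a x, S x -> S (a *: x).
Proof.
by move=> SS a x Sx; rewrite -[_ *: _]addr0; apply: star_subalgebraD => //;
  apply: star_subalgebra0.
Qed.

Lemma star_subalgebraN (S : set A) : star_subalgebra S ->
  forall x, S x -> S (- x).
Proof. by move=> SS x Sx; rewrite -scaleN1r; apply: star_subalgebraZ. Qed.

Lemma star_subalgebraA (S : set A) : star_subalgebra S ->
  forall x y, S x -> S y -> S (x + y).
Proof. by move=> SS x y Sx Sy; rewrite -[x]scale1r; apply: star_subalgebraD. Qed.

(** Combined with the clause that a square root lies in every closed *-subalgebra containing the
    radicand, this shows that the root commutes with [y] as soon as the radicand does. *)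
Lemma commutant_star_subalgebra y : cstar y = y ->
  star_subalgebra [set x | x ** y = y ** x].
Proof.
move=> yy; split => /=; first by rewrite cmul0l cmul0r.
- by move=> a x z xy zy; rewrite cmulDl cmulDr cmulZl cmulZr xy zy.
- by move=> x z xy zy; rewrite -cmulA zy cmulA xy cmulA.
- by move=> x xy; rewrite -[y in LHS]yy -cstarM -xy cstarM yy.
Qed.

Lemma commutant_closed y : closed [set x | x ** y = y ** x].
Proof.
apply: closed_nrm => x xe /=; apply/eqP; rewrite -subr_eq0; apply/eqP.
apply: nrm_small => e e0; have y0 := nrm_ge0 y.
have [|z /= zy xz] := xe (e / (2 * (nrm y + 1))).
  by rewrite divr_gt0// mulr_gt0// ltr_wpDl.
have -> : x ** y - y ** x = (x - z) ** y - y ** (x - z).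
  by rewrite cmulBl cmulBr zy opprB addrA subrK.
rewrite (le_trans (nrmB _ _))// (le_trans (lerD (nrmM _ _) (nrmM _ _)))//.
rewrite [nrm y * _]mulrC -mulrDr.
rewrite (le_trans (ler_wpM2r _ xz)) ?addr_ge0//.
rewrite -mulrA ler_piMr ?(ltW e0)// mulrC ler_pdivrMr ?mul1r; last first.
  by rewrite mulr_gt0// ltr_wpDl.
by lra.
Qed.

(** The scalar majorant of the square root iteration. The step t -> (1 + t^2) / 2 has 1 as a double
    fixed point, so convergence to 1 is only of order 1/n. *)
Fixpoint sqrt_seq (n : nat) : R :=
  if n is m.+1 then (1 + sqrt_seq m ^+ 2) / 2 else 0.

Lemma sqrt_seq_ge0 n : 0 <= sqrt_seq n.
Proof. by case: n => //= n; rewrite divr_ge0// addr_ge0// sqr_ge0. Qed.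

Lemma sqrt_seq_le1 n : sqrt_seq n <= 1.
Proof.
elim: n => //= n IH; rewrite ler_pdivrMr// mul1r.
by have := sqrt_seq_ge0 n; nra.
Qed.

Lemma sqrt_seqS n : sqrt_seq n <= sqrt_seq n.+1.
Proof.
rewrite /= ler_pdivlMr//; have := sqr_ge0 (sqrt_seq n - 1); rewrite sqrrB1.
by lra.
Qed.

Lemma sqrt_seq_mono m n : (m <= n)%N -> sqrt_seq m <= sqrt_seq n.
Proof.
move=> /subnK <-; elim: (n - m)%N => // d IH.
by rewrite (le_trans IH)// sqrt_seqS.
Qed.

(** One step multiplies the defect 1 - q by (1 + q) / 2; the induction then comes down to (1 - q)^2
    >= 0. *)
Lemma sqrt_seq_cvg1 n : (1 - sqrt_seq n) * n.+1%:R <= 2.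
Proof.
elim: n => [|n]; first by rewrite /= subr0 mul1r ler1n.
have := sqrt_seq_le1 n; have := sqrt_seq_ge0 n.
rewrite [sqrt_seq n.+1]/= -(natr1 n.+1).
move: (sqrt_seq n) (n.+1%:R : R) (ler0n R n.+1) => q s s0 q0 q1 IH.
have : (1 - q) * s * (1 + q) <= 2 * (1 + q) by rewrite ler_wpM2r// addr_ge0.
by nra.
Qed.

Lemma sqrt_seq_lim e : 0 < e ->
  exists N, forall n, (N <= n)%N -> 1 - sqrt_seq n <= e.
Proof.
move=> e0; pose N := Num.bound (2 / e).
have Ne : 2 < e * N.+1%:R.
  rewrite mulrC -ltr_pdivrMr//.
  apply: (@lt_trans _ _ N%:R); last by rewrite ltr_nat.
  by rewrite archi_boundP// divr_ge0// ltW.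
exists N => n Nn; have N0 : 0 < N.+1%:R :> R by rewrite ltr0n.
apply: (@le_trans _ _ (1 - sqrt_seq N)).
  by rewrite lerD2l lerN2 sqrt_seq_mono.
rewrite -(ler_pM2r N0) (le_trans (sqrt_seq_cvg1 N))//.
exact: ltW.
Qed.

Lemma cvg_dominated (u : nat -> A) (C : R) : 0 <= C ->
  (forall n, nrm (u n.+1 - u n) <= C * (sqrt_seq n.+1 - sqrt_seq n)) ->
  exists l : A, u @ \oo --> l.
Proof.
move=> C0 uq; apply: cauchy_nrm_cvg => e e0.
have [|N /(_ N (leqnn _)) CN] := @sqrt_seq_lim (e / (C + 1)).
  by rewrite divr_gt0// ltr_wpDl.
have {}CN : C * (1 - sqrt_seq N) <= e.
  move: CN; rewrite ler_pdivlMr ?ltr_wpDl// mulrC; apply: le_trans.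
  by rewrite ler_wpM2r ?subr_ge0 ?sqrt_seq_le1// lerDl.
exists N => n Nn; apply: le_trans CN.
apply: (@le_trans _ _ (C * (sqrt_seq n - sqrt_seq N))); last first.
  by rewrite ler_wpM2l// lerD2r sqrt_seq_le1.
rewrite -(subnK Nn); elim: (n - N)%N => [|d IH].
  by rewrite !add0n !subrr nrm0 mulr0.
rewrite addSn (le_trans (nrm_dist _ (u (d + N)%N) _))//.
rewrite (le_trans (lerD (uq _) IH))// -mulrDr.
by rewrite addrA subrK.
Qed.

(** Testing on b = x^* and using the C*-identity: estimates of left multiplication operators are
    estimates of norms. *)
Lemma nrm_le_op x (C : R) : 0 <= C ->
  (forall b, nrm (x ** b) <= C * nrm b) -> nrm x <= C.
Proof.
move=> C0 /(_ (cstar x)).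
rewrite -{1}[x]cstarK nrm_star_sqr nrm_star expr2.
have := nrm_ge0 x; rewrite le_eqVlt => /predU1P[<- //|x0].
by rewrite ler_pM2r.
Qed.

Lemma scale_half2 x : (2^-1 : R)%:C *: (x + x) = x.
Proof.
rewrite -mulr2n -[x *+ 2]scaler_nat scalerA.
have -> : (2^-1 : R)%:C * 2%:R = 1 :> R[i].
  by rewrite -(rmorph_nat (real_complex R)) -rmorphM/= mulVf ?pnatr_eq0.
by rewrite scale1r.
Qed.

(* A simultaneous treatment of two square roots: for [lam = 1], [c] is a
   square root of [p]; for [lam = 0], [1 + c] is one of [1 + p].  The operator
   [K n] is the n-th iterate, started at 0, of [K -> (lam - p + K^2) / 2],
   dominated by the same iteration [sqrt_seq] with [lam - p] replaced by 1;
   as the algebra need not be unital, only [lam * sqrt_seq n - K n] is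
   realized, by [y n]. *)
Lemma sqrt_exists (lam : R) p : lam ^+ 2 = lam -> cstar p = p ->
  (forall b, nrm (lam%:C *: b - p ** b) <= nrm b) ->
  exists c, [/\ c + c = p - c ** c + lam%:C *: (c + c), cstar c = c,
    forall b, nrm (lam%:C *: b - c ** b) <= nrm b &
    forall S : set A, star_subalgebra S -> closed S -> S p -> S c].
Proof.
move=> lam2 pp pb.
pose q := sqrt_seq; pose hf : R[i] := (2^-1 : R)%:C.
(* This is K -> (lam - p + K^2) / 2 after the substitution K = lam q - y: the scalar terms cancel
   because of lam^2 = lam (see [qS]), which leaves a step within the algebra. *)
pose y n := iteri n
  (fun n y => hf *: (p - y ** y) + (lam * q n)%:C *: y) 0.
have yS n : y n.+1 = hf *: (p - y n ** y n) + (lam * q n)%:C *: y n by [].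
pose K n b := (lam * q n)%:C *: b - y n ** b.
have KB n b b' : K n b - K n b' = K n (b - b').
  rewrite /K scalerBr cmulBr opprB addrACA opprB [RHS]addrACA.
  by congr (_ + _); rewrite addrC.
have qS n : lam * q n.+1 = 2^-1 * (lam + (lam * q n) ^+ 2).
  by rewrite exprMn lam2 /q/=; field.
have KS n b : K n.+1 b = hf *: (lam%:C *: b - p ** b + K n (K n b)).
  rewrite /K yS qS rmorphM rmorphD rmorphXn/= -scalerA cmulDl !cmulZl -/hf.
  set t := (lam * q n)%:C.
  have -> : t *: (y n ** b) = hf *: (t *: (y n ** b) + t *: (y n ** b)).
    by rewrite scale_half2.
  rewrite -scalerDr -scalerBr; congr (_ *: _).
  rewrite scalerDl cmulBl cmulBr cmulZr scalerBr scalerA -expr2 cmulA.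
  set u := y n ** b; set v := y n ** y n ** b.
  rewrite -!addrA; congr (_ + _); rewrite !opprD !opprK !addrA.
  rewrite [_ - p ** b]addrC -!addrA; congr (_ + (_ + _)).
by rewrite addrC -addrA.
have q0 n : 0 <= q n by exact: sqrt_seq_ge0.
have hfE x : nrm (hf *: x) = 2^-1 * nrm x by rewrite nrmZr// invr_ge0.
have Kb n b : nrm (K n b) <= q n * nrm b.
  elim: n b => [|n IH] b.
    by rewrite /K/= mulr0 scale0r cmul0l subr0 nrm0 mul0r.
  rewrite KS hfE mulrC ler_pdivrMr// -mulrA (mulrC _ 2) mulrA.
  have -> : q n.+1 = (1 + q n ^+ 2) / 2 by [].
    have -> : (1 + q n ^+ 2) / 2 * 2 * nrm b = nrm b + q n ^+ 2 * nrm b by field.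
    rewrite (le_trans (nrmD _ _))// lerD//.
  by rewrite (le_trans (IH _))// expr2 -mulrA ler_wpM2l.
have KD n b : nrm (K n.+1 b - K n b) <= (q n.+1 - q n) * nrm b.
  elim: n b => [|n IH] b.
    rewrite {2}/K/= mulr0 scale0r cmul0l subr0 subr0 KS hfE.
    rewrite {2}/K/= mulr0 scale0r cmul0l !subr0 expr0n/= addr0 mul1r.
    by rewrite {1}/K/= mulr0 scale0r cmul0l subrr addr0 ler_wpM2l// invr_ge0.
  rewrite KS [X in _ - X]KS -scalerBr hfE mulrC ler_pdivrMr//.
  rewrite opprD addrACA subrr add0r.
  (* With K' the next iterate, K'^2 - K^2 = K' (K' - K) + (K' - K) K; the majorants of the two terms
     add up exactly to the next increment of [sqrt_seq]. *)
  rewrite (le_trans (nrm_dist _ (K n.+1 (K n b)) _))// KB.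
  rewrite (le_trans (lerD (Kb _ _) (IH _)))//.
  apply: (@le_trans _ _ (q n.+1 * ((q n.+1 - q n) * nrm b) +
     (q n.+1 - q n) * (q n * nrm b))).
    by apply: lerD; rewrite ler_wpM2l ?IH ?Kb ?q0// subr_ge0 sqrt_seqS.
  rewrite le_eqVlt; apply/orP; left; apply/eqP.
  have -> : q n.+2 = (1 + q n.+1 ^+ 2) / 2 by [].
  have -> : q n.+1 = (1 + q n ^+ 2) / 2 by [].
  by field.
have lam1 : 0 <= lam <= 1.
  have : lam * (lam - 1) == 0 by rewrite mulrBr mulr1 -expr2 lam2 subrr.
  by rewrite mulf_eq0 subr_eq0 => /orP[]/eqP ->; rewrite lexx ler01.
have /andP[lam_ge0 lam_le1] := lam1.
have [|c yc] := @cvg_dominated y 2 (ler0n _ _).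
  move=> n; apply: nrm_le_op; first by rewrite mulr_ge0// subr_ge0 sqrt_seqS.
  move=> b.
  have -> : (y n.+1 - y n) ** b =
      (lam * (q n.+1 - q n))%:C *: b - (K n.+1 b - K n b).
    have -> : (lam * (q n.+1 - q n))%:C = (lam * q n.+1)%:C - (lam * q n)%:C.
      by rewrite mulrBr rmorphB.
    rewrite scalerBl cmulBl /K.
    set s1 := (lam * q n.+1)%:C; set s0 := (lam * q n)%:C.
    abel.
  rewrite (le_trans (nrmB _ _))// -mulrA mulr2n mulrDl mul1r lerD// nrmZr.
    rewrite ler_wpM2r ?nrm_ge0// ler_piMl// subr_ge0 sqrt_seqS//.
  by rewrite mulr_ge0// subr_ge0 sqrt_seqS.
have yself n : cstar (y n) = y n.
  elim: n => [|n IH]; first by rewrite cstar0.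
  by rewrite yS cstarD !cstarZr cstarB cstarM IH pp.
have ySS n (S : set A) : star_subalgebra S -> S p -> S (y n).
  move=> SS Sp; elim: n => [|n IH]; first exact: star_subalgebra0.
  rewrite yS; apply: star_subalgebraD => //; last exact: star_subalgebraZ.
  apply: star_subalgebraA => //; apply: star_subalgebraN => //.
  exact: star_subalgebraM.
have qlim : (fun n => (lam * q n)%:C : R[i]^o) @ \oo --> (lam%:C : R[i]^o).
  apply/cvg_nrmP => e e0; have [N qN] := sqrt_seq_lim e0.
  exists N => n /qN {}qN.
  have -> : (lam * q n)%:C - lam%:C = - (lam * (1 - q n))%:C.
    by rewrite mulrBr mulr1 rmorphB opprB.
  rewrite /nrm normrN -/(cabs _) cabs_real; last first.
    by rewrite mulr_ge0// subr_ge0 sqrt_seq_le1.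
  by rewrite (le_trans _ qN)// ler_piMl// subr_ge0 sqrt_seq_le1.
exists c; split.
- have c2 : c = hf *: (p - c ** c) + lam%:C *: c.
    apply: (cvg_uniq (u := fun n => y n.+1)); first by rewrite cvg_shiftS.
    rewrite (_ : (fun n => y n.+1) = fun n =>
      hf *: (p - y n ** y n) + (lam * q n)%:C *: y n)//.
    apply: cvgD; last exact: cvgZ.
    apply: cvgZl_tmp; apply: cvgB; first exact: cvg_cst.
    exact: cvg_cmul.
  rewrite {1 2}c2 addrACA -!scalerDr scale_half2.
  by rewrite scalerDr.
- apply: (cvg_uniq (u := y)) => //.
  by have := cvg_cstar yc; rewrite (funext yself).
- move=> b; apply: (@cvg_nrm_le _ _ (fun n => K n b)).
    apply: cvgB; last exact: cvg_cmulr.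
    exact: cvgZr_tmp.
  by exists 0%N => n _; rewrite (le_trans (Kb _ _))// ler_piMl ?nrm_ge0// sqrt_seq_le1.
- by move=> S SS Sc Sp; apply: (closed_seq Sc _ yc) => n; exact: ySS.
Qed.

(** The last relation says h^2 + (1 - k)^2 = 1, so that h + i (1 - k) and h - i (1 - k) are formally
    unitary. They act on b as isometries, and h b and (up to the factor i) b - k b are their half
    sum and half difference. *)
Lemma unitary_parts h k : cstar h = h -> cstar k = k -> h ** k = k ** h ->
    h ** h + k ** k = k + k ->
  forall b, nrm (h ** b) <= nrm b /\ nrm (b - k ** b) <= nrm b.
Proof.
move=> hh kk hk hk2 b.
set P := h ** b; set Q := b - k ** b.
have PPQQ : cstar P ** P + cstar Q ** Q = cstar b ** b.
  rewrite /P /Q cstarB !cstarM hh kk cmulBl !cmulBr.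
  have -> : cstar b ** k ** (k ** b) = cstar b ** (k ** k) ** b.
    by rewrite !cmulA.
  have -> : cstar b ** h ** (h ** b) = cstar b ** (h ** h) ** b.
    by rewrite !cmulA.
  have -> : h ** h = k + k - k ** k by rewrite -hk2 addrK.
  rewrite cmulBr cmulBl cmulDr cmulDl.
  rewrite -!cmulA; abel.
have PQQP : cstar P ** Q = cstar Q ** P.
  rewrite /P /Q cstarB !cstarM hh kk cmulBl !cmulBr; congr (_ - _).
    by rewrite cmulA.
  by rewrite !cmulA -[_ ** h ** k]cmulA hk cmulA.
have W (s : R[i]) : s^* = - s -> s * s = -1 -> nrm (P + s *: Q) = nrm b.
  move=> sc s2; apply/eqP; rewrite -(@eqrXn2 _ 2)// ?nrm_ge0// -!nrm_star_sqr.
  rewrite cstarD cstarZ sc cmulDl !cmulDr !cmulZl !cmulZr PQQP scalerA mulNr s2.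
  by rewrite opprK scale1r scaleNr addrA addrK PPQQ.
have Wi : nrm (P + 'i *: Q) = nrm b.
  by apply: W; [rewrite conjCi|rewrite -expr2 sqrCi].
have WNi : nrm (P + (- 'i) *: Q) = nrm b.
  by apply: W; [rewrite rmorphN/= conjCi|rewrite mulrNN -expr2 sqrCi].
have half x y : nrm x = nrm b -> nrm y = nrm b ->
    nrm ((2^-1 : R)%:C *: (x + y)) <= nrm b.
  move=> xb yb; rewrite nrmZr ?invr_ge0// mulrC ler_pdivrMr//.
  by rewrite (le_trans (nrmD _ _))// xb yb mulr_natr mulr2n.
split.
  rewrite -[P]scale_half2.
  have -> : P + P = (P + 'i *: Q) + (P + (- 'i) *: Q).
    by rewrite addrACA -scalerDl subrr scale0r addr0.
  exact: half.
have -> : nrm Q = nrm ('i *: Q).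
  by rewrite nrmZ /cabs normCi mul1r.
rewrite -['i *: Q]scale_half2.
have -> : 'i *: Q + 'i *: Q = (P + 'i *: Q) + - (P + (- 'i) *: Q).
  by rewrite opprD addrACA subrr add0r scaleNr opprK.
by apply: half => //; rewrite nrmN.
Qed.

(** Here k stands for 1 - (1 - h^2)^(1/2), which makes sense without a unit: it is - c for the case
    [lam = 0], p = - h^2 of [sqrt_exists]. *)
Lemma unit_ball_defect h : cstar h = h -> nrm h <= 1 ->
  exists k, [/\ cstar k = k, h ** k = k ** h, h ** h + k ** k = k + k &
    forall S : set A, star_subalgebra S -> closed S -> S h -> S k].
Proof.
move=> hh h1.
have [||b|c [c2 cc _ cS]] := @sqrt_exists 0 (- (h ** h)).
- by rewrite expr0n.
- by rewrite cstarN cstarM hh.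
- rewrite scale0r sub0r cmulNl opprK (le_trans (nrmM _ _))//.
  rewrite ler_piMl ?nrm_ge0// (le_trans (nrmM _ _))//.
  by rewrite mulr_ile1 ?nrm_ge0.
exists (- c).
have hhS S : star_subalgebra S -> S h -> S (- (h ** h)).
  by move=> SS Sh; apply: star_subalgebraN => //; apply: star_subalgebraM.
split.
- by rewrite cstarN cc.
- rewrite cmulNr cmulNl; congr (- _); apply/esym.
  have := cS _ (commutant_star_subalgebra hh) (@commutant_closed h); apply => /=.
  by rewrite cmulNl cmulNr cmulA.
- rewrite -opprD c2 scale0r addr0 cmulNl cmulNr opprK.
  by rewrite opprB opprK addrC.
- by move=> S SS Sc Sh; apply: star_subalgebraN => //; apply: cS => //; apply: hhS.
Qed.

End Sqrt.

Section Contractive.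
Context {R : realType} {A B : cstarAlgType R}.

(** Relative to a subset because contractivity is needed for maps defined on the degree 0
    subalgebra, which is not turned into a C*-algebra of its own. *)
Record star_hom_on (S : set A) (f : A -> B) : Prop := {
  star_hom_onD : forall (a : R[i]) x y, S x -> S y ->
    f (a *: x + y) = a *: f x + f y;
  star_hom_onM : forall x y, S x -> S y -> f (x ** y) = f x ** f y;
  star_hom_onS : forall x, S x -> f (cstar x) = cstar (f x) }.

(* For selfadjoint [h] in the unit ball, [h + i (1 - h ^+ 2)^(1/2)] is unitary
   and [f] maps it to a unitary, of which [f h] is the real part. *)
Lemma star_hom_on_le (S : set A) (f : A -> B) :
  star_subalgebra S -> closed S -> star_hom_on S f ->
  forall x, S x -> nrm (f x) <= nrm x.
Proof.
move=> SS Sc [fD fM fS] x Sx.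
have f0 : f 0 = 0.
  have S0 := star_subalgebra0 SS.
  have := fD 1 0 0 S0 S0; rewrite !scale1r addr0 => /eqP.
  by rewrite -subr_eq0 opprD addNKr oppr_eq0 => /eqP.
have fZ a y : S y -> f (a *: y) = a *: f y.
  move=> Sy; have := fD a y 0 Sy (star_subalgebra0 SS).
  by rewrite !addr0 f0 addr0.
have fA y z : S y -> S z -> f (y + z) = f y + f z.
  by move=> Sy Sz; have := fD 1 y z Sy Sz; rewrite !scale1r.
have H h : S h -> cstar h = h -> nrm h <= 1 -> nrm (f h) <= 1.
  move=> Sh hh h1; have [k [kk hk hk2 kS]] := unit_ball_defect hh h1.
  have Sk := kS _ SS Sc Sh.
  (* The vector is f h itself, so the bound reads |f h|^2 <= |f h|. *)
  have [||||fh _] := @unitary_parts _ _ (f h) (f k) _ _ _ _ (f h).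
  - by rewrite -fS// hh.
  - by rewrite -fS// kk.
  - by rewrite -!fM// hk.
  - by rewrite -!fM// -!fA ?hk2//; apply: star_subalgebraM.
  move: fh; rewrite nrm_selfadj_sqr; last by rewrite -fS// hh.
  have := nrm_ge0 (f h); rewrite le_eqVlt => /predU1P[<- _|fh0].
    exact: ler01.
  by rewrite expr2 -{3}[nrm (f h)]mul1r ler_pM2r.
have := nrm_ge0 x; rewrite le_eqVlt => /predU1P[x0|x0].
  by rewrite -x0 (nrm_eq0 (esym x0)) f0 nrm0.
pose r := nrm x ^+ 2; have r0 : 0 < r by rewrite exprn_gt0.
pose h := (r^-1)%:C *: (cstar x ** x).
have Sxx : S (cstar x ** x).
  by apply: star_subalgebraM => //; apply: star_subalgebraS.
have := H h (star_subalgebraZ SS _ Sxx).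
have hs : cstar h = h by rewrite /h cstarZr cstarM cstarK.
have h1 : nrm h <= 1.
  have r1 : r^-1 * r = 1 by rewrite mulVf// gt_eqF.
  by rewrite /h nrmZr ?invr_ge0 ?(ltW r0)// nrm_star_sqr r1 lexx.
move=> /(_ hs h1); rewrite /h.
rewrite fZ// fM//; last exact: star_subalgebraS.
rewrite fS// nrmZr ?invr_ge0 ?(ltW r0)// nrm_star_sqr mulrC ler_pdivrMr// mul1r.
by rewrite /r ler_sqr ?nnegrE ?nrm_ge0.
Qed.

Lemma star_hom_le (f : A -> B) : star_hom f -> forall x, nrm (f x) <= nrm x.
Proof.
move=> [fl fM fS] x; apply: (@star_hom_on_le setT) => //.
by split=> // a y z _ _; exact: fl.
Qed.

End Contractive.

(** * Positive elements *)

(** Exponential growth beats linear growth. With k = 2^m and u = 1 + d, Bernoulli's inequality,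
    squared, gives (k d)^2 <= u^(2 k) <= C + 2 D k, hence k d^2 <= C + 2 D for every m. This removes
    linear factors from norm bounds on powers. *)
Lemma pow_growth_le1 (R : realType) (u C D : R) :
  0 <= u -> 0 <= C -> 0 <= D ->
  (forall m, u ^+ (2 ^ m) <= C + D * (2 ^ m)%:R) -> u <= 1.
Proof.
move=> u0 C0 D0 uCD; rewrite leNgt; apply/negP => u1.
pose d := u - 1; have d0 : 0 < d by rewrite subr_gt0.
have bern n : 1 + n%:R * d <= u ^+ n.
  elim: n => [|n IH]; first by rewrite mul0r addr0 expr0.
  have uE : u = 1 + d by rewrite /d addrC subrK.
  have nd : 0 <= n%:R * d ^+ 2 by rewrite mulr_ge0// sqr_ge0.
  rewrite exprS (le_trans _ (ler_wpM2l u0 IH))// uE -natr1.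
  have -> : (1 + d) * (1 + n%:R * d) = 1 + (n%:R + 1) * d + n%:R * d ^+ 2 by ring.
  by rewrite lerDl.
have key m : (2 ^ m)%:R * d ^+ 2 <= C + 2 * D.
  have k1 : 1 <= (2 ^ m)%:R :> R by rewrite ler1n expn_gt0.
  have := uCD m.+1; rewrite expnS mulnC exprM natrM.
  have := bern (2 ^ m)%N.
  move: (u ^+ (2 ^ m)) ((2 ^ m)%:R : R) k1 => w k k1 wk.
  have kd0 : 0 <= k * d by rewrite mulr_ge0 ?(ltW d0)// (le_trans _ k1).
  have kw : (k * d) ^+ 2 <= w ^+ 2.
    by rewrite ler_sqr ?nnegrE//; lra.
  move=> /(le_trans kw); rewrite exprMn => h.
  have k0 : 0 < k by lra.
  rewrite -(ler_pM2l k0) mulrA -expr2 (le_trans h)//; nra.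
pose m := Num.bound ((C + 2 * D) / d ^+ 2).
have : (C + 2 * D) / d ^+ 2 < (2 ^ m)%:R.
  apply: (@lt_trans _ _ m%:R); last by rewrite ltr_nat ltn_expl.
  by rewrite archi_boundP// divr_ge0 ?addr_ge0 ?mulr_ge0// ltW.
rewrite ltr_pdivrMr ?exprn_gt0// => /lt_le_trans/(_ (key m)).
by rewrite ltxx.
Qed.

Section Positive.
Context {R : realType} {A : cstarAlgType R}.
Implicit Types x y z b c h k p : A.

(* Positivity in the sense of Kelley and Vaught, with the norm of the
   unitization replaced by that of left multiplication operators. *)
Definition cpos p := cstar p = p /\
  exists2 t : R, 0 < t & forall b, nrm (t%:C *: b - p ** b) <= t * nrm b.

(** For g = h / |h| and k the defect of g, 1 - g^2 = (1 - k)^2, and 1 - k is a contraction by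
    [unitary_parts]. *)
Lemma sqr_op_le h : cstar h = h -> forall b,
  nrm ((nrm h ^+ 2)%:C *: b - h ** h ** b) <= nrm h ^+ 2 * nrm b.
Proof.
move=> hh b; have := nrm_ge0 h; rewrite le_eqVlt => /predU1P[h0|h0].
  rewrite -h0 (nrm_eq0 (esym h0)) expr0n/= !cmul0l subr0 scale0r nrm0.
  by rewrite mul0r.
pose r := nrm h; have r0 : r != 0 by rewrite gt_eqF.
pose g := (r^-1)%:C *: h.
have gg : cstar g = g by rewrite /g cstarZr hh.
have g1 : nrm g <= 1 by rewrite /g nrmZr ?invr_ge0 ?(ltW h0)// mulVf ?lexx.
have hg : h = r%:C *: g.
  by rewrite /g scalerA -rmorphM/= mulfV// scale1r.
have [k [kk hk hk2 _]] := unit_ball_defect gg g1.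
have kb x : nrm (x - k ** x) <= nrm x by have [] := unitary_parts gg kk hk hk2 x.
rewrite -/r {1 2}hg cmulZl cmulZr cmulZl cmulZl scalerA -rmorphM/= -expr2 -scalerBr.
rewrite nrmZr ?sqr_ge0// ler_wpM2l ?sqr_ge0//.
have -> : b - g ** g ** b = (b - k ** b) - k ** (b - k ** b).
  have -> : g ** g = k + k - k ** k by rewrite -hk2 addrK.
  by rewrite cmulBl cmulDl cmulBr cmulA; abel.
by rewrite (le_trans (kb _)).
Qed.

Lemma cpos_sqr h : cstar h = h -> cpos (h ** h).
Proof.
move=> hh; split; first by rewrite cstarM hh.
have := nrm_ge0 h; rewrite le_eqVlt => /predU1P[h0|h0].
  exists 1 => // b; rewrite (nrm_eq0 (esym h0)) !cmul0l subr0 mul1r.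
  by rewrite scale1r.
by exists (nrm h ^+ 2); [rewrite exprn_gt0|exact: sqr_op_le].
Qed.

Lemma cpos_add p k : cpos p -> cpos k -> cpos (p + k).
Proof.
move=> [pp [s s0 ps]] [kk [t t0 kt]]; split; first by rewrite cstarD pp kk.
exists (s + t); first by rewrite addr_gt0.
move=> b; rewrite rmorphD/= scalerDl cmulDl opprD addrACA mulrDl.
by rewrite (le_trans (nrmD _ _))// lerD.
Qed.

Lemma cpos_half p : cpos (p + p) -> cpos p.
Proof.
move=> [pp [t t0 pt]]; split.
  by rewrite -[p]scale_half2 cstarZr pp.
exists (2^-1 * t); first by rewrite mulr_gt0// invr_gt0.
move=> b; rewrite -mulrA -[p]scale_half2 rmorphM/= -scalerA cmulZl -scalerBr.
by rewrite nrmZr ?invr_ge0// ler_wpM2l// invr_ge0.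
Qed.

(** The case [lam = 1] of [sqrt_exists] at p / t, rescaled by the root of t. The contraction clause
    of that lemma is what makes the root positive again. *)
Lemma cpos_sqrt p : cpos p -> exists c, [/\ c ** c = p, cstar c = c, cpos c &
  forall S : set A, star_subalgebra S -> closed S -> S p -> S c].
Proof.
move=> [pp [t t0 pt]].
have tE : t = Num.sqrt t * Num.sqrt t by rewrite -expr2 sqr_sqrtr// ltW.
have t0' : t != 0 by rewrite gt_eqF.
have [||b|c [c2 cc cb cS]] := @sqrt_exists _ _ 1 ((t^-1)%:C *: p).
- by rewrite expr1n.
- by rewrite cstarZr pp.
- rewrite scale1r.
  have -> : b - (t^-1)%:C *: p ** b = (t^-1)%:C *: (t%:C *: b - p ** b).
    by rewrite scalerBr scalerA -rmorphM/= mulVf// scale1r cmulZl.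
  rewrite nrmZr ?invr_ge0 ?(ltW t0)// mulrC ler_pdivrMr// mulrC.
  exact: pt.
have {}c2 : c ** c = (t^-1)%:C *: p.
  move: c2; rewrite scale1r => /eqP; rewrite -subr_eq subrr eq_sym subr_eq0.
  by move=> /eqP.
pose s := Num.sqrt t; have s0 : 0 < s by rewrite sqrtr_gt0.
exists (s%:C *: c); split.
- rewrite cmulZl cmulZr scalerA -rmorphM/= -tE c2 scalerA -rmorphM/= mulfV//.
  by rewrite scale1r.
- by rewrite cstarZr cc.
- split; first by rewrite cstarZr cc.
  exists s => // b; rewrite cmulZl -scalerBr nrmZr ?(ltW s0)//.
  by rewrite ler_wpM2l ?(ltW s0)//; have := cb b; rewrite scale1r.
- move=> S SS Sc Sp; apply: star_subalgebraZ => //; apply: cS => //.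
  exact: star_subalgebraZ.
Qed.

(** Writing p as a square replaces the unspecified constant in [cpos] by the norm of p. *)
Lemma cpos_op_le p : cpos p ->
  forall b, nrm ((nrm p)%:C *: b - p ** b) <= nrm p * nrm b.
Proof.
move=> /cpos_sqrt[c [<- cc _ _]] b.
by rewrite nrm_selfadj_sqr//; exact: sqr_op_le.
Qed.

(* If [r] is the norm of [p], then [r + p] and [r - p] have norm at most [r],
   whereas the difference of their squares is [4 * r * p]. *)
Lemma cpos_anti p : cpos p -> cpos (- p) -> p = 0.
Proof.
move=> pp np; set r := nrm p.
have M b : nrm (r%:C *: b - p ** b) <= r * nrm b by exact: cpos_op_le.
have P b : nrm (r%:C *: b + p ** b) <= r * nrm b.
  by have := cpos_op_le np b; rewrite nrmN cmulNl opprK.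
have r0 : 0 <= r := nrm_ge0 _.
pose P1 := r%:C *: p + p ** p; pose M1 := r%:C *: p - p ** p.
have E : (r%:C *: P1 + p ** P1) - (r%:C *: M1 - p ** M1) =
    (4 * r)%:C *: (p ** p).
  rewrite /P1 /M1 !(scalerDr, scalerN, cmulDr, cmulNr, cmulZr).
  have -> : (4 * r)%:C *: (p ** p) = r%:C *: (p ** p) + r%:C *: (p ** p) +
      r%:C *: (p ** p) + r%:C *: (p ** p).
    rewrite -!scalerDl -!rmorphD/=; congr (_%:C *: _); lra.
  by abel.
have p_self : cstar p = p by case: pp.
apply: nrm_eq0; rewrite -/r; apply/eqP; rewrite eq_le r0 andbT leNgt.
apply/negP => r1; have : 4 * r * r ^+ 2 <= r * (r * r) + r * (r * r).
  rewrite -[r ^+ 2]nrm_selfadj_sqr// -nrmZr ?mulr_ge0// -E.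
  rewrite (le_trans (nrmB _ _))// lerD//.
    by rewrite (le_trans (P _))// ler_wpM2l// P.
  by rewrite (le_trans (M _))// ler_wpM2l// M.
have r3 : 0 < r * (r * r) by rewrite !mulr_gt0.
by rewrite -mulrA expr2; lra.
Qed.

(* The n-th power of [t - b^* b] differs from [t ^+ n] by [b^* q b], with [q] a
   polynomial in [b b^*] of norm at most [n * t ^+ (n - 1)]; hence the spectral
   radius of [t - b^* b], which is its norm, is at most [t]. *)
Lemma cpos_swap b : cpos (b ** cstar b) -> cpos (cstar b ** b).
Proof.
move=> [_ [t t0 bt]]; split; first by rewrite cstarM cstarK.
exists t => // x.
pose Q x := t%:C *: x - cstar b ** b ** x.
pose P x := t%:C *: x - b ** cstar b ** x.
have bQ y : b ** Q y = P (b ** y) by rewrite /Q /P cmulBr cmulZr !cmulA.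
have bQn n y : b ** iter n Q y = iter n P (b ** y).
  by elim: n y => //= n IH y; rewrite bQ IH.
have Pn n y : nrm (iter n P y) <= t ^+ n * nrm y.
  elim: n => [|n IH] /=; first by rewrite mul1r.
  by rewrite (le_trans (bt _))// exprS -mulrA ler_wpM2l// ltW.
set K := nrm b ^+ 2.
have Qn n : t * nrm (iter n Q x) <= t ^+ n * (t + n%:R * K) * nrm x.
  elim: n => [|n IH] /=; first by rewrite expr0 mul1r mul0r addr0.
  rewrite [Q (iter n Q x)]/Q -cmulA bQn.
  apply: (@le_trans _ _ (t * (t ^+ n * (t + n%:R * K) * nrm x +
      nrm b * (t ^+ n * (nrm b * nrm x))))).
    rewrite ler_wpM2l ?(ltW t0)// (le_trans (nrmB _ _))// lerD//.
      by rewrite nrmZr ?(ltW t0).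
    rewrite (le_trans (nrmM _ _))// nrm_star ler_wpM2l ?nrm_ge0//.
    rewrite (le_trans (Pn _ _))// ler_wpM2l ?exprn_ge0 ?(ltW t0)//.
    exact: nrmM.
  rewrite le_eqVlt; apply/orP; left; apply/eqP.
  by rewrite exprS -natr1 /K; ring.
have Qsym y z : cstar (Q y) ** z = cstar y ** Q z.
  rewrite /Q cstarB cstarZr !cstarM cstarK cmulBl cmulBr cmulZl cmulZr.
  by rewrite !cmulA.
have Qsymn n y z : cstar (iter n Q y) ** z = cstar y ** iter n Q z.
  by elim: n y z => //= n IH y z; rewrite Qsym IH -iterSr.
(* Log-convexity of the orbit norms, from the symmetry of Q. It serves as the spectral radius
   formula: the normalized norms [v] satisfy v(n)^2 <= v(2 n), while [Qn] bounds them linearly. *)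
have logc n : nrm (iter n Q x) ^+ 2 <= nrm x * nrm (iter (2 * n) Q x).
  rewrite -nrm_star_sqr Qsymn -iterD addnn -mul2n -[nrm x]nrm_star.
  exact: nrmM.
have := nrm_ge0 x; rewrite le_eqVlt => /predU1P[x0|x0].
  by rewrite (nrm_eq0 (esym x0)) scaler0 cmul0r subr0 nrm0 mulr0.
pose v n := nrm (iter n Q x) / (t ^+ n * nrm x).
have v0 n : 0 <= v n by rewrite divr_ge0 ?mulr_ge0 ?exprn_ge0 ?nrm_ge0// ltW.
have vS n : v n ^+ 2 <= v (2 * n)%N.
  rewrite /v expr_div_n ler_pdivrMr ?exprn_gt0 ?mulr_gt0 ?exprn_gt0//.
  rewrite (le_trans (logc n))// le_eqVlt; apply/orP; left; apply/eqP.
  by rewrite exprMn -exprM mulnC; field; rewrite ?expf_neq0 ?gt_eqF.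
have vm m : v 1%N ^+ (2 ^ m) <= v (2 ^ m)%N.
  elim: m => [|m IH]; first by rewrite expn0 expr1.
  rewrite expnS (le_trans _ (vS _))// mulnC exprM.
  by rewrite ler_sqr ?nnegrE ?exprn_ge0.
have : v 1%N <= 1.
  apply: (@pow_growth_le1 _ _ 1 (K / t)) => // [|m].
    by rewrite divr_ge0 ?sqr_ge0// ltW.
  rewrite (le_trans (vm m))// /v ler_pdivrMr ?mulr_gt0 ?exprn_gt0//.
  rewrite -(ler_pM2l t0) (le_trans (Qn _))// le_eqVlt; apply/orP; left.
  by apply/eqP; field; rewrite gt_eqF.
by rewrite /v ler_pdivrMr ?mulr_gt0 ?exprn_gt0// mul1r expr1.
Qed.

Lemma cpos_oppC b : cpos (- (cstar b ** b)) -> b = 0.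
Proof.
move=> nb; have bb : cpos (b ** cstar b).
  pose X := b + cstar b; pose Y : A := 'i *: (b - cstar b).
  have XX : cstar X = X by rewrite /X cstarD cstarK addrC.
  have YY : cstar Y = Y.
    by rewrite /Y cstarZ conjCi cstarB cstarK scaleNr -scalerN opprB.
  apply: cpos_half.
  have -> : b ** cstar b + b ** cstar b = X ** X + Y ** Y +
      (- (cstar b ** b) + - (cstar b ** b)).
    rewrite /Y cmulZl cmulZr scalerA -expr2 sqrCi scaleN1r /X.
    by rewrite !(cmulDl, cmulDr, cmulNl, cmulNr); abel.
  by apply: cpos_add; apply: cpos_add => //; apply: cpos_sqr.
apply: nrm_eq0; apply/eqP; rewrite -(@sqrf_eq0 R) -nrm_star_sqr.
by rewrite (cpos_anti (cpos_swap bb) nb) nrm0.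
Qed.

(** With h = a^* a, the root c of h^2 is |h|, and n = |h| - h is twice the negative part. From h n =
    - c n follows (a n)^* (a n) = - (s n)^2 with s the root of c, so a n = 0 by [cpos_oppC]; then h
    n and c n vanish, so n^2 = 0 and h = |h| is positive. *)
Theorem star_sqrt a : exists c, [/\ cstar c = c, c ** c = cstar a ** a &
  forall S : set A, star_subalgebra S -> closed S -> S (cstar a ** a) -> S c].
Proof.
set h := cstar a ** a.
have hh : cstar h = h by rewrite /h cstarM cstarK.
have [c [c2 cc cp cS]] := cpos_sqrt (cpos_sqr hh).
have hc : c ** h = h ** c.
  apply: (cS _ (commutant_star_subalgebra hh) (@commutant_closed _ _ h)).
  by rewrite /= -cmulA.
pose n := c - h.
have nn : cstar n = n by rewrite /n cstarB cc hh.
have cn : c ** n = n ** c by rewrite /n cmulBl cmulBr hc.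
have [s [s2 ss _ sS]] := cpos_sqrt cp.
have sn : s ** n = n ** s.
  exact: (sS _ (commutant_star_subalgebra nn) (@commutant_closed _ _ n)).
have hn : h ** n = - (c ** n).
  by rewrite /n !cmulBr hc c2 opprB.
have an0 : a ** n = 0.
  apply: cpos_oppC.
  have -> : - (cstar (a ** n) ** (a ** n)) = (s ** n) ** (s ** n).
    rewrite cstarM nn cmulA -[n ** cstar a ** a]cmulA -/h -cmulA hn cmulNr.
    by rewrite opprK -s2 -[s ** s ** n]cmulA cmulA -sn.
  by apply: cpos_sqr; rewrite cstarM nn ss.
have cn0 : c ** n = 0.
  by apply/eqP; rewrite -oppr_eq0 -hn /h -cmulA an0 cmul0r.
have n0 : n = 0.
  apply: nrm_eq0; apply/eqP; rewrite -(@sqrf_eq0 R) -nrm_selfadj_sqr//.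
  by rewrite {1}/n cmulBl cn0 hn cn0 oppr0 subrr nrm0.
have hcE : h = c by apply/eqP; rewrite -subr_eq0 -oppr_eq0 opprB -/n n0.
have [d [d2 dd _ dS]] := cpos_sqrt cp.
by exists d; rewrite hcE; split.
Qed.

End Positive.

(** * Spectral subspaces of circle actions *)

Section Circle.
Context {R : realType}.
Implicit Types (z w : R[i]) (s t : R) (k : int).

Lemma circleE z : circle z <-> cabs z = 1.
Proof.
rewrite /circle/= cabsE; split=> [[]//|->]; by rewrite rmorph1.
Qed.

Lemma circle1 : circle (1 : R[i]).
Proof. by rewrite /circle/= normr1. Qed.

Lemma circleV z : circle z -> circle z^-1.
Proof. by rewrite /circle/= normfV => ->; rewrite invr1. Qed.

Lemma circleX z n : circle z -> circle (z ^+ n).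
Proof. by rewrite /circle/= normrX => ->; rewrite expr1n. Qed.

Lemma circle_neq0 z : circle z -> z != 0.
Proof. by move=> z1; rewrite -normr_eq0 (_ : `|z| = 1)// oner_eq0. Qed.

Lemma circleXz z k : circle z -> circle (z ^ k).
Proof.
by case: k => n z1; [exact: circleX|exact: (circleV (circleX n.+1 z1))].
Qed.

Lemma circle_conj z : circle z -> z^* = z^-1.
Proof.
move=> z1; apply: (mulfI (circle_neq0 z1)).
by rewrite -normCK (_ : `|z| = 1)// expr1n mulfV// circle_neq0.
Qed.

Definition expi t : R[i] := cos t +i* sin t.

Lemma expiD s t : expi (s + t) = expi s * expi t.
Proof.
apply/eqP; rewrite eq_complex /= cosD sinD eqxx/=; apply/eqP; ring.
Qed.

Lemma expi0 : expi 0 = 1.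
Proof. by rewrite /expi cos0 sin0. Qed.

Lemma expi_circle t : circle (expi t).
Proof.
apply/circleE; apply/eqP; rewrite -(@eqrXn2 _ 2)// ?cabs_ge0// expr1n.
by rewrite cabs_sqr /= cos2Dsin2.
Qed.

Lemma expiMn t n : expi (n%:R * t) = expi t ^+ n.
Proof.
elim: n => [|n IH]; first by rewrite mul0r expi0.
by rewrite -natr1 mulrDl mul1r expiD IH exprSr.
Qed.

Lemma expi2pi : expi (2 * pi) = 1.
Proof. by rewrite mulr_natl /expi cos2pi sin2pi. Qed.

Lemma expipi : expi pi = -1.
Proof. by rewrite /expi cospi sinpi; apply/eqP; rewrite eq_complex/= oppr0 !eqxx. Qed.

Lemma expi_surj z : circle z -> exists2 t, 0 <= t & z = expi t.
Proof.
move=> /circleE z1; have : cabs z ^+ 2 = 1 by rewrite z1 expr1n.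
rewrite cabs_sqr; case: z z1 => a b _ /= ab.
have a1 : -1 <= a <= 1.
  by apply/andP; split; nra.
have bE : Num.sqrt (1 - a ^+ 2) = `|b|.
  by rewrite -ab addrC addKr sqrtr_sqr.
have [b0|b0] := leP 0 b.
  exists (acos a); first exact: acos_ge0.
  by rewrite /expi acosK// sin_acos// bE ger0_norm.
exists (2 * pi - acos a).
  have := acos_lepi a1; have := @pi_gt0 R; lra.
rewrite expiD expi2pi mul1r /expi cosN sinN acosK// sin_acos// bE.
by rewrite ltr0_norm// opprK.
Qed.

Lemma expi_near1 e : 0 < e ->
  exists2 d, 0 < d & forall t, `|t| <= d -> cabs (expi t - 1) <= e.
Proof.
move=> e0; have := @continuous_cos R 0.
(* The constant comes from |e^(it) - 1|^2 = 2 (1 - cos t). *)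
move=> /cvgrPdist_le/(_ (e ^+ 2 / 2))[|d /= d0 dP].
  by rewrite divr_gt0// exprn_gt0.
exists (d / 2); first by rewrite divr_gt0.
move=> t td; rewrite -ler_sqr ?nnegrE ?cabs_ge0 ?(ltW e0)//.
rewrite cabs_sqr /=.
have := dP t; rewrite /= sub0r normrN cos0 => /(_ _)/wrap[].
  by rewrite (le_lt_trans td)// ltr_pdivrMr// ltr_pMr// ltr1n.
move=> ct.
have := cos2Dsin2 t; have := ler_norm (1 - cos t); nra.
Qed.

(** Orders that are powers of 2 make the groups of roots nested, so each mean arises from the
    previous one by a single halving step. *)
Definition zeta n : R[i] := expi (2 * pi / (2 ^ n)%:R).

Lemma zeta_circle n : circle (zeta n).
Proof. exact: expi_circle. Qed.

Lemma zetaX n : zeta n ^+ (2 ^ n) = 1.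
Proof.
rewrite /zeta -expiMn mulrC divfK ?expi2pi// pnatr_eq0 -lt0n expn_gt0//.
Qed.

Lemma zetaS n : zeta n.+1 ^+ 2 = zeta n.
Proof.
rewrite /zeta -expiMn expnS natrM invfM mulrCA [2 * (2^-1 * _)]mulrA mulfV ?mul1r//.
by rewrite pnatr_eq0.
Qed.

Lemma zeta_half n : zeta n.+1 ^+ (2 ^ n) = -1.
Proof.
rewrite /zeta -expiMn expnS natrM.
rewrite (_ : _ * _ = pi) ?expipi//; field; rewrite pnatr_eq0 -lt0n expn_gt0//.
Qed.

Lemma big_ord_double (V : nmodType) n (F : nat -> V) :
  \sum_(j < 2 * n) F j = \sum_(j < n) (F (2 * j)%N + F (2 * j).+1).
Proof.
elim: n => [|n IH]; first by rewrite muln0 !big_ord0.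
by rewrite mulnS !add2n !big_ord_recr/= IH addrA.
Qed.

(* The average of [z ^ k] over the roots of unity of order [2 ^ n]. *)
Fixpoint root_avg k n : R[i] :=
  if n is m.+1 then root_avg k m * ((2^-1)%:C * (1 + zeta n ^ k)) else 1.

Lemma root_avg0 n : root_avg 0 n = 1.
Proof.
elim: n => //= n ->; rewrite expr0z mul1r -[1 + 1]/(2%:R).
by rewrite -(rmorph_nat (real_complex R)) -rmorphM/= mulVf ?pnatr_eq0.
Qed.

(** Write |k| = 2^l q with q odd: then zeta(l + 1)^k = -1, so the factor of index l + 1 vanishes,
    and l < |k| <= n guarantees that this factor occurs. *)
Lemma root_avg_eq0 k n : k != 0 -> (`|k| <= n)%N -> root_avg k n = 0.
Proof.
move=> k0 kn; pose m := `|k|%N.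
have m0 : (0 < m)%N by rewrite absz_gt0.
pose l := logn 2 m.
have [q q2 mq] := @pfactor_coprime 2 m isT m0.
rewrite coprime2n in q2.
have zm : zeta l.+1 ^+ m = -1.
  by rewrite mq mulnC exprM zeta_half -signr_odd q2 expr1.
have zk : zeta l.+1 ^ k = -1.
  have [k1|k1] := leP 0 k; first by rewrite -(gez0_abs k1) -exprnP.
  rewrite -[k]opprK -(ltz0_abs k1) -invr_expz -exprnP zm.
  by rewrite invrN invr1.
have : (l < n)%N by rewrite (leq_trans _ kn)// ltn_logl.
move=> /subnK <-; elim: (n - l.+1)%N => [|d IH].
  by rewrite add0n /= zk subrr !mulr0.
by rewrite addSn /= IH mul0r.
Qed.

End Circle.

(** * Spectral projections as limits of means, and Fejer's theorem *)

Section CircleAction.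
Context {R : realType} {B : cstarAlgType R} (g : R[i] -> B -> B).
Hypothesis hg : circle_action g.
Implicit Types (x y : B) (z w : R[i]) (k l : int).

Lemma action_le z x : circle z -> nrm (g z x) <= nrm x.
Proof. by move=> /(circle_action_aut hg)[gz _]; exact: star_hom_le. Qed.

Lemma action1 x : g 1 x = x.
Proof.
have [_ /bij_inj] := circle_action_aut hg (@circle1 R); apply.
by rewrite -(circle_actionM hg) ?mul1r//; exact: circle1.
Qed.

Lemma action_nrm z x : circle z -> nrm (g z x) = nrm x.
Proof.
move=> z1; apply/le_anti; rewrite action_le//= -{1}[x]action1.
rewrite -(mulVf (circle_neq0 z1)) (circle_actionM hg)//; last exact: circleV.
exact/action_le/circleV.
Qed.

Lemma actionP z a x y : circle z -> g z (a *: x + y) = a *: g z x + g z y.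
Proof. by move=> /(circle_action_aut hg)[[gl _ _] _]; exact: gl. Qed.

Lemma actionD z x y : circle z -> g z (x + y) = g z x + g z y.
Proof. by move=> z1; have := actionP 1 x y z1; rewrite !scale1r. Qed.

Lemma action0 z : circle z -> g z 0 = 0.
Proof.
move=> z1; have := actionD 0 0 z1; rewrite addr0 => /eqP.
by rewrite -subr_eq0 opprD addNKr oppr_eq0 => /eqP.
Qed.

Lemma actionZ z a x : circle z -> g z (a *: x) = a *: g z x.
Proof. by move=> z1; have := actionP a x 0 z1; rewrite !addr0 action0// addr0. Qed.

Lemma actionB z x y : circle z -> g z (x - y) = g z x - g z y.
Proof. by move=> z1; rewrite actionD// -scaleN1r actionZ// scaleN1r. Qed.

Lemma action_near1 x e : 0 < e ->
  exists2 d : R, 0 < d & forall z, circle z -> cabs (z - 1) <= d ->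
    nrm (g z x - x) <= e.
Proof.
move=> e0; have /subspace_continuousP := @circle_action_cts _ _ _ hg x.
move=> /(_ 1 circle1)/cvgrPdist_le/(_ e%:C).
rewrite ltcR => /(_ e0)/nbhs_ballP[d /= d0 dP].
have dE : d = (complex.Re d)%:C by rewrite RRe_real// gtr0_real.
have d0' : 0 < complex.Re d by rewrite -ltcR -dE.
exists (complex.Re d / 2); first by rewrite divr_gt0.
move=> z z1 zd; have := dP z.
rewrite -ball_normE /ball_/= distrC cabsE dE ltcR.
rewrite /from_subspace/= action1 distrC nrmE lecR.
apply=> //; rewrite (le_lt_trans zd)// ltr_pdivrMr// ltr_pMr// ltr1n//.
Qed.

(* The multiple of [g] whose fixed points are the elements of degree [k]. *)
Definition twist k z x : B := z ^ (- k) *: g z x.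

Lemma twist_nrm k z x : circle z -> nrm (twist k z x) = nrm x.
Proof.
move=> z1; rewrite /twist nrmZ action_nrm//.
by have /circleE -> := circleXz (- k) z1; rewrite mul1r.
Qed.

Lemma twistP k z a x y : circle z ->
  twist k z (a *: x + y) = a *: twist k z x + twist k z y.
Proof.
by move=> z1; rewrite /twist actionP// scalerDr !scalerA mulrC.
Qed.

Lemma twistB k z x y : circle z -> twist k z (x - y) = twist k z x - twist k z y.
Proof. by move=> z1; rewrite /twist actionB// scalerBr. Qed.

Lemma twistD k z x y : circle z -> twist k z (x + y) = twist k z x + twist k z y.
Proof. by move=> z1; rewrite /twist actionD// scalerDr. Qed.

Lemma twistZ k z a x : circle z -> twist k z (a *: x) = a *: twist k z x.
Proof. by move=> z1; rewrite /twist actionZ// !scalerA mulrC. Qed.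

Lemma twistM k z w x : circle z -> circle w ->
  twist k (z * w) x = twist k z (twist k w x).
Proof.
move=> z1 w1; rewrite /twist (circle_actionM hg)// actionZ// scalerA.
by rewrite expfzMl.
Qed.

Lemma twist1 k x : twist k 1 x = x.
Proof. by rewrite /twist action1 exp1rz scale1r. Qed.

Lemma cabs_int k z d : circle z -> cabs (z - 1) <= d ->
  cabs (z ^ k - 1) <= `|k|%N%:R * d.
Proof.
move=> z1 zd; have P n : cabs (z ^+ n - 1) <= n%:R * d.
  elim: n => [|n IH]; first by rewrite subrr mul0r /cabs normr0.
  have -> : z ^+ n.+1 - 1 = z ^+ n * (z - 1) + (z ^+ n - 1).
    by rewrite exprSr; ring.
  rewrite (le_trans (cabsD _ _))// cabsM -natr1 mulrDl addrC mul1r lerD//.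
  by have /circleE -> := circleX n z1; rewrite mul1r.
case: k => n; first exact: P.
have zn : circle (z ^+ n.+1) by exact: circleX.
have -> : z ^ Negz n - 1 = - (z ^ Negz n * (z ^+ n.+1 - 1)).
  by rewrite NegzE -invr_expz -exprnP mulrBr mulVf ?circle_neq0// mulr1 opprB.
rewrite /cabs normrN -/(cabs _) cabsM.
by have /circleE -> := circleXz (Negz n) z1; rewrite mul1r; exact: P.
Qed.

Lemma twist_near1 k x e : 0 < e ->
  exists2 d : R, 0 < d & forall t, `|t| <= d ->
    nrm (twist k (expi t) x - x) <= e.
Proof.
move=> e0; have [|d1 d10 P1] := @action_near1 x (e / 2); first exact: divr_gt0.
pose c := `|k|%N%:R * nrm x + 1.
have c0 : 0 < c by rewrite ltr_wpDl// mulr_ge0// nrm_ge0.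
pose e1 := Num.min d1 (e / 2 / c).
have e10 : 0 < e1 by rewrite lt_min d10 !divr_gt0.
have [d d0 P2] := expi_near1 e10; exists d => // t /P2 {P2}.
set z := expi t; have z1 : circle z := expi_circle t.
rewrite le_min => /andP[zd zc].
have -> : twist k z x - x = z ^ (- k) *: (g z x - x) + (z ^ (- k) - 1) *: x.
  by rewrite /twist scalerBr scalerBl scale1r addrA subrK.
rewrite (le_trans (nrmD _ _))// [e]splitr lerD//.
  rewrite nrmZ; have /circleE -> := circleXz (- k) z1.
  by rewrite mul1r P1.
rewrite nrmZ (le_trans (ler_wpM2r (nrm_ge0 _) (cabs_int _ z1 zc)))//.
rewrite abszN.
have -> : `|k|%N%:R * (e / 2 / c) * nrm x = e / 2 * (`|k|%N%:R * nrm x / c).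
  by field; rewrite gt_eqF.
rewrite ler_piMr//; first by rewrite divr_ge0// ltW.
by rewrite ler_pdivrMr// mul1r /c lerDl.
Qed.

(** The twisted mean over 2^d equally spaced points of the arc from 1 to [zeta n], built one binary
    digit of the angle at a time. The mean over all roots of order 2^(n + d) is [avg k n] applied to
    it ([avg_add]), so refining a mean is a local operation. *)
Fixpoint avg_from k n d x : B :=
  if d is d'.+1 then
    avg_from k n d' ((2^-1)%:C *: (x + twist k (zeta (n + d').+1) x))
  else x.

Definition avg k n x := avg_from k 0 n x.

Lemma avg_fromP k n d a x y :
  avg_from k n d (a *: x + y) = a *: avg_from k n d x + avg_from k n d y.
Proof.
elim: d x y => //= d IH x y; rewrite -IH twistP//; last exact: zeta_circle.
congr (avg_from _ _ _ _).
by rewrite !(scalerDr, scalerA) [a * _]mulrC; abel.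
Qed.

Lemma avg_fromZ k n d a x : avg_from k n d (a *: x) = a *: avg_from k n d x.
Proof.
have f0 : avg_from k n d 0 = 0.
  by have := avg_fromP k n d (-1) 0 0; rewrite scaler0 addr0 scaleN1r addNr.
by have := avg_fromP k n d a x 0; rewrite !addr0 f0 addr0.
Qed.

Lemma avg_fromD k n d x y :
  avg_from k n d (x + y) = avg_from k n d x + avg_from k n d y.
Proof. by have := avg_fromP k n d 1 x y; rewrite !scale1r. Qed.

Lemma avg_fromB k n d x y :
  avg_from k n d (x - y) = avg_from k n d x - avg_from k n d y.
Proof. by rewrite addrC -scaleN1r avg_fromP scaleN1r addrC. Qed.

Lemma avg_from_le k n d x : nrm (avg_from k n d x) <= nrm x.
Proof.
elim: d x => //= d IH x; rewrite (le_trans (IH _))// nrmZr ?invr_ge0//.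
rewrite ler_pdivrMl// (le_trans (nrmD _ _))// twist_nrm; last exact: zeta_circle.
by rewrite mulr_natl mulr2n.
Qed.

Lemma avg_add k n d x : avg k (n + d) x = avg k n (avg_from k n d x).
Proof. by elim: d x => [|d IH] x; rewrite ?addn0// addnS -IH. Qed.

Lemma twist_avg_from k n d z x : circle z ->
  twist k z (avg_from k n d x) = avg_from k n d (twist k z x).
Proof.
move=> z1; elim: d x => //= d IH x; rewrite IH twistZ// twistD//.
rewrite -!twistM//; [|exact: zeta_circle..].
by rewrite mulrC.
Qed.

Lemma avg_sum k n x :
  avg k n x = ((2 ^ n)%:R^-1)%:C *: \sum_(j < 2 ^ n) twist k (zeta n ^+ j) x.
Proof.
elim: n x => [|n IH] x.
  by rewrite big_ord1 expr0 twist1 invr1 scale1r.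
have -> : avg k n.+1 x = avg k n ((2^-1)%:C *: (x + twist k (zeta n.+1) x)).
  by [].
rewrite IH expnS (big_ord_double _ (fun j => twist k (zeta n.+1 ^+ j) x)).
rewrite natrM invfM mulrC rmorphM/= -scalerA; congr (_ *: _).
rewrite scaler_sumr; apply: eq_bigr => j _.
have zn1 := @zeta_circle R n.+1.
have zj : circle (zeta n ^+ j : R[i]) by apply/circleX/zeta_circle.
rewrite twistZ// twistD// -twistM// -zetaS -exprM.
by rewrite mulrC -exprS.
Qed.

Lemma avg_twist_zeta k n i x : avg k n (twist k (zeta n ^+ i) x) = avg k n x.
Proof.
elim: i x => [|i IH] x; first by rewrite twist1.
rewrite exprSr twistM; [|exact/circleX/zeta_circle|exact: zeta_circle].
rewrite IH !avg_sum; congr (_ *: _).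
have M0 : (0 < 2 ^ n)%N by rewrite expn_gt0.
have zM := @zetaX R n; rewrite -(prednK M0) in zM *.
rewrite [LHS]big_ord_recr [RHS]big_ord_recl /= addrC; congr (_ + _).
  rewrite -twistM; [|exact/circleX/zeta_circle|exact: zeta_circle].
  by rewrite -exprSr zM expr0.
apply: eq_bigr => j _.
rewrite -twistM; [|exact/circleX/zeta_circle|exact: zeta_circle].
by rewrite -exprSr.
Qed.

(** The angle compared with [tau] is that of the last of the 2^d points. The start t is arbitrary
    because the induction splits these points into two interleaved families, starting at t and at t
    + s. *)
Lemma avg_from_near k n d x e (tau t : R) :
  (forall t, 0 <= t -> t <= tau -> nrm (twist k (expi t) x - x) <= e) ->
  0 <= t -> t + 2 * pi / (2 ^ n)%:R * (1 - (2 ^ d)%:R^-1) <= tau ->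
  nrm (avg_from k n d (twist k (expi t) x) - x) <= e.
Proof.
move=> near; elim: d t => [|d IH] t t0 ttau /=.
  by apply: near => //; move: ttau; rewrite expn0 invr1 subrr mulr0 addr0.
have pi0 := @pi_gt0 R.
pose s : R := 2 * pi / (2 ^ (n + d).+1)%:R.
rewrite -[zeta _]/(expi s).
have s0 : 0 <= s by rewrite divr_ge0// mulr_ge0// ltW.
have sE : s = 2 * pi / (2 ^ n)%:R * (2 ^ d.+1)%:R^-1.
  by rewrite /s -addnS expnD natrM invfM mulrA.
have dd : (2 ^ d)%:R^-1 = 2 * (2 ^ d.+1)%:R^-1 :> R.
  by rewrite expnS natrM invfM mulrA mulfV ?mul1r// pnatr_eq0.
rewrite -twistM; [|exact: expi_circle..].
rewrite -expiD avg_fromZ avg_fromD.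
set a := avg_from _ _ _ _; set b := avg_from _ _ _ _.
have -> : (2^-1)%:C *: (a + b) - x = (2^-1)%:C *: ((a - x) + (b - x)).
  rewrite -{1}[x]scale_half2 -scalerBr; congr (_ *: _); abel.
rewrite nrmZr ?invr_ge0// ler_pdivrMl// mulr_natl mulr2n.
rewrite (le_trans (nrmD _ _))// lerD//.
  apply: IH => //; rewrite (le_trans _ ttau)// lerD2l ler_wpM2l//.
    by rewrite divr_ge0// mulr_ge0// ltW.
  by rewrite lerD2l lerN2 dd ler_peMl ?invr_ge0// ler1n.
apply: IH; first by rewrite addr_ge0.
rewrite (le_trans _ ttau)// le_eqVlt; apply/orP; left; apply/eqP.
by rewrite sE dd; ring.
Qed.

Lemma zeta_angle_small (d : R) : 0 < d ->
  exists N, forall n, (N <= n)%N -> 2 * pi / (2 ^ n)%:R <= d.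
Proof.
move=> d0; have pi0 := @pi_gt0 R; pose N := Num.bound (d^-1 * (2 * pi)).
exists N => n Nn.
have n2 : 0 < (2 ^ n)%:R :> R by rewrite ltr0n expn_gt0.
rewrite ler_pdivrMr// -ler_pdivrMl// ltW//.
apply: (@lt_trans _ _ N%:R).
  by rewrite archi_boundP// mulr_ge0 ?invr_ge0 ?mulr_ge0// ltW.
by rewrite ltr_nat (leq_ltn_trans Nn)// ltn_expl.
Qed.

(** Later means differ from the N-th by the N-th mean of a local mean minus x, and the local mean
    runs over an arc too short to move x by more than e. *)
Lemma avg_cvg k x : exists l : B, (fun n => avg k n x) @ \oo --> l.
Proof.
apply: cauchy_nrm_cvg => e e0; have [d d0 dP] := twist_near1 k x e0.
have [N NP] := zeta_angle_small d0; exists N => n /subnKC <-.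
rewrite avg_add -avg_fromB (le_trans (avg_from_le _ _ _ _))//.
rewrite -[x in avg_from _ _ _ x](twist1 k) -expi0.
apply: (@avg_from_near k N _ x e d) => //.
  by move=> t t0 td; apply: dP; rewrite ger0_norm.
rewrite add0r (le_trans _ (NP _ (leqnn _)))// ler_piMr//.
  by rewrite divr_ge0// mulr_ge0// ltW// pi_gt0.
by rewrite lerBlDr lerDl invr_ge0.
Qed.

(** The k-th Fourier coefficient of z -> g_z x: the integral of z^(-k) g_z x for the normalized Haar
    measure. *)
Definition spec_proj k x : B := lim ((fun n => avg k n x) @ \oo).

Lemma spec_proj_cvg k x : (fun n => avg k n x) @ \oo --> spec_proj k x.
Proof. by apply/cvg_ex; exact: avg_cvg. Qed.

Lemma spec_projP k a x y :
  spec_proj k (a *: x + y) = a *: spec_proj k x + spec_proj k y.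
Proof.
apply: (cvg_uniq (@spec_proj_cvg _ _)).
under eq_fun do rewrite /avg avg_fromP.
by apply: cvgD; [apply: cvgZl_tmp|]; exact: spec_proj_cvg.
Qed.

Lemma spec_proj_le k x : nrm (spec_proj k x) <= nrm x.
Proof.
apply: (cvg_nrm_le (@spec_proj_cvg k x)).
by exists 0%N => n _; exact: avg_from_le.
Qed.

Definition degree k : set B :=
  [set x | forall z, circle z -> g z x = z ^ k *: x].

Lemma spec_proj_degree k x : degree k (spec_proj k x).
Proof.
move=> z z1.
suff : twist k z (spec_proj k x) = spec_proj k x.
  rewrite /twist => {2}<-; rewrite scalerA -expfzDr ?circle_neq0// subrr.
  by rewrite expr0z scale1r.
apply/eqP; rewrite -subr_eq0; apply/eqP; apply: nrm_small => e e0.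
have [t t0 zt] := expi_surj z1.
have [d d0 dP] := twist_near1 k x e0.
have [N NP] := zeta_angle_small d0.
apply: (@cvg_nrm_le _ _ (fun n => twist k z (avg k n x) - avg k n x)).
  apply: cvgB; last exact: spec_proj_cvg.
  apply: (cvg_lip (C := 1)); last exact: spec_proj_cvg.
  by move=> u v; rewrite -twistB// twist_nrm// mul1r.
exists N => n /NP nd; rewrite /avg twist_avg_from//.
have an0 : 0 < 2 * pi / (2 ^ n)%:R :> R.
  by rewrite divr_gt0 ?mulr_gt0 ?pi_gt0// ltr0n expn_gt0.
(* z is a power of [zeta n], under which the mean is invariant, times a rotation by less than the
   angle of [zeta n], which moves x by at most e. *)
pose i := Num.truncn (t / (2 * pi / (2 ^ n)%:R)).
have /andP[it ti] : i%:R <= t / (2 * pi / (2 ^ n)%:R) < i.+1%:R.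
  by apply: truncn_itv; rewrite divr_ge0// ltW.
rewrite ler_pdivlMr// in it; rewrite ltr_pdivrMr// -natr1 mulrDl mul1r in ti.
have -> : z = zeta n ^+ i * expi (t - i%:R * (2 * pi / (2 ^ n)%:R)).
  by rewrite /zeta -expiMn -expiD addrC subrK zt.
rewrite twistM; [|exact/circleX/zeta_circle|exact: expi_circle].
rewrite -/(avg _ _ _) avg_twist_zeta -avg_fromB (le_trans (avg_from_le _ _ _ _))//.
by apply: dP; rewrite ger0_norm; lra.
Qed.

Lemma avg_degree k l n x : degree l x -> avg k n x = root_avg (l - k) n *: x.
Proof.
move=> xl; elim: n => [|n IH]; first by rewrite scale1r.
rewrite /avg/= add0n /twist xl ?zeta_circle//; last exact: zeta_circle.
rewrite scalerA -expfzDr; last exact/circle_neq0/zeta_circle.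
rewrite -{1}[x]scale1r -scalerDl scalerA avg_fromZ -/(avg _ _ _) IH scalerA.
by rewrite mulrC addrC.
Qed.

Lemma spec_proj_id k x : degree k x -> spec_proj k x = x.
Proof.
move=> xk; apply: (cvg_uniq (@spec_proj_cvg _ _)).
under eq_fun do rewrite (avg_degree _ _ xk) subrr root_avg0 scale1r.
exact: cvg_cst.
Qed.

Lemma spec_proj_eq0 k l x : degree l x -> k != l -> spec_proj k x = 0.
Proof.
move=> xl kl; apply: (cvg_uniq (@spec_proj_cvg _ _)).
apply/cvg_nrmP => e e0; exists `|l - k|%N => n ln.
rewrite (avg_degree _ _ xl) root_avg_eq0//; last by rewrite subr_eq0 eq_sym.
by rewrite scale0r subr0 nrm0 ltW.
Qed.


Lemma root_avg_sum k n :
  root_avg k n = ((2 ^ n)%:R^-1 : R)%:C * \sum_(j < 2 ^ n) (zeta n ^+ j) ^ k.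
Proof.
elim: n => [|n IH]; first by rewrite big_ord1 expr0 exp1rz invr1 mulr1.
rewrite /= IH expnS (big_ord_double _ (fun j => (zeta n.+1 ^+ j : R[i]) ^ k)).
rewrite natrM invfM mulrC rmorphM/= -!mulrA; congr (_ * _).
rewrite mulrCA; congr (_ * _); rewrite mulr_sumr; apply: eq_bigr => j _.
by rewrite mulrDl mul1r exprS expfzMl exprM zetaS.
Qed.

Definition fejer_kernel N z : R := N%:R^-1 * cabs (\sum_(a < N) z ^+ a) ^+ 2.

Lemma fejer_kernel_ge0 N z : 0 <= fejer_kernel N z.
Proof. by rewrite mulr_ge0 ?invr_ge0// sqr_ge0. Qed.

Lemma fejer_kernelE N z : circle z -> (fejer_kernel N z)%:C =
  (N%:R^-1 : R)%:C * \sum_(a < N) \sum_(b < N) z ^ (a%:Z - b%:Z).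
Proof.
move=> z1; rewrite rmorphM/= rmorphXn/= -cabsE normCK rmorph_sum/=.
congr (_ * _); rewrite mulr_suml; apply: eq_bigr => a _.
rewrite mulr_sumr; apply: eq_bigr => b _.
by rewrite rmorphXn/= circle_conj// expfzDr ?circle_neq0// -invr_expz exprVn.
Qed.

(** Expanding the square, a term with a different from b averages to 0 by [root_avg_eq0], as |a - b|
    < N <= n; the N diagonal terms, divided by N, give 1. *)
Lemma fejer_kernel_mass N n : (0 < N <= n)%N ->
  (2 ^ n)%:R^-1 * \sum_(j < 2 ^ n) fejer_kernel N (zeta n ^+ j) = 1.
Proof.
move=> /andP[N0 Nn]; apply: real_complex_inj; rewrite rmorphM rmorph_sum/=.
have -> : \sum_(j < 2 ^ n) (fejer_kernel N (zeta n ^+ j))%:C =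
    (N%:R^-1 : R)%:C * \sum_(a < N) \sum_(b < N)
      \sum_(j < 2 ^ n) (zeta n ^+ j) ^ (a%:Z - b%:Z).
  have zj j : circle (zeta n ^+ j : R[i]) by apply/circleX/zeta_circle.
  rewrite (eq_bigr _ (fun (j : 'I__) _ => fejer_kernelE N (zj j))) -mulr_sumr.
  congr (_ * _); rewrite exchange_big; apply: eq_bigr => a _.
  by rewrite exchange_big.
rewrite mulrCA mulr_sumr.
rewrite (eq_bigr (fun=> 1)) => [|a _].
  rewrite sumr_const card_ord -(rmorph_nat (real_complex R)) -rmorphM/=.
  by rewrite mulVf// pnatr_eq0 -lt0n.
rewrite mulr_sumr (bigD1 a)//= -root_avg_sum subrr root_avg0 big1 ?addr0// => b ba.
rewrite -root_avg_sum root_avg_eq0//.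
  by rewrite subr_eq0 eq_sym; apply: contra ba => /eqP[/val_inj ->].
have := ltn_ord a; have := ltn_ord b; lia.
Qed.

(** The geometric sum S satisfies S (z - 1) = z^N - 1, of modulus at most 2. *)
Lemma fejer_kernel_far N z d : (0 < N)%N -> circle z -> 0 < d ->
  d <= cabs (z - 1) -> fejer_kernel N z <= 4 / (N%:R * d ^+ 2).
Proof.
move=> N0 z1 d0 dz; have N0' : 0 < N%:R :> R by rewrite ltr0n.
rewrite /fejer_kernel invfM [leRHS]mulrCA ler_wpM2l ?invr_ge0//.
rewrite ler_pdivlMr ?exprn_gt0// -exprMn.
set S := \sum_(a < N) z ^+ a.
have : cabs (S * (z - 1)) <= 2.
  rewrite mulrC -subrX1 (le_trans (cabsD _ _))// /cabs normrN -/(cabs _).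
  have /circleE -> := circleX N z1.
  by rewrite normr1 /= -[1 + 1]/(2%:R).
rewrite cabsM => Sz; have S0 := cabs_ge0 S.
have Sd : cabs S * d <= 2 by rewrite (le_trans _ Sz)// ler_wpM2l.
have Sd0 : 0 <= cabs S * d by rewrite mulr_ge0// ltW.
by nra.
Qed.

(** The Cesaro mean of the Fourier series: the degree k occurs N - |k| times as a - b, which gives
    the weight 1 - |k| / N. *)
Definition fejer N x : B :=
  (N%:R^-1 : R)%:C *: \sum_(a < N) \sum_(b < N) spec_proj (a%:Z - b%:Z) x.

(** The approximate identity argument at a finite level n >= N, where the discretized Fejer sum is a
    mean of g_z x with nonnegative weights of total mass exactly 1. Continuity handles z near 1,
    decay of the kernel the rest; the bounds do not depend on n, hence pass to the limit. *)
Lemma fejer_cvg x e : 0 < e -> exists N, nrm (fejer N x - x) <= e.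
Proof.
move=> e0; have [|d d0 dP] := @action_near1 x (e / 2); first exact: divr_gt0.
(* The far bound 4 / (N d^2) times |g_z x - x| <= 2 |x| equals c / N. *)
pose c := 8 * nrm x / d ^+ 2.
have c0 : 0 <= c by rewrite divr_ge0 ?mulr_ge0 ?nrm_ge0 ?(ltW d0).
pose N := (Num.bound (c / (e / 2))).+1.
have N0 : 0 < N%:R :> R by rewrite ltr0n.
have cN : c / N%:R <= e / 2.
  rewrite ler_pdivrMr// -ler_pdivrMl ?divr_gt0// mulrC ltW//.
  apply: (@lt_trans _ _ (Num.bound (c / (e / 2)))%:R); last by rewrite ltr_nat.
  by rewrite archi_boundP// divr_ge0// divr_ge0// ltW.
exists N.
apply: (@cvg_nrm_le _ _ (fun n => (N%:R^-1 : R)%:C *: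
    (\sum_(a < N) \sum_(b < N) avg (a%:Z - b%:Z) n x) - x)).
  apply: cvgB; last exact: cvg_cst.
  apply: cvgZl_tmp; apply: cvg_sum => a; apply: cvg_sum => b.
  exact: spec_proj_cvg.
exists N => n Nn; pose m : R := (2 ^ n)%:R^-1.
have m0 : 0 <= m by rewrite invr_ge0.
pose F j := fejer_kernel N (zeta n ^+ j).
have F0 j : 0 <= F j by exact: fejer_kernel_ge0.
have Fm : m * \sum_(j < 2 ^ n) F j = 1 by exact: fejer_kernel_mass.
have zj j : circle (zeta n ^+ j : R[i]) by apply/circleX/zeta_circle.
have -> : (N%:R^-1 : R)%:C *: (\sum_(a < N) \sum_(b < N) avg (a%:Z - b%:Z) n x)
    = m%:C *: \sum_(j < 2 ^ n) (F j)%:C *: g (zeta n ^+ j) x.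
  under eq_bigr => a _ do under eq_bigr => b _ do rewrite avg_sum.
  under eq_bigr => a _ do rewrite -scaler_sumr.
  rewrite -scaler_sumr scalerA mulrC -scalerA; congr (_ *: _).
  under [X in _ *: X = _]eq_bigr => a _ do rewrite exchange_big.
  rewrite exchange_big scaler_sumr; apply: eq_bigr => j _.
  rewrite /F fejer_kernelE// -scalerA; congr (_ *: _).
  rewrite scaler_suml exchange_big; apply: eq_bigr => b _; rewrite scaler_suml.
  by apply: eq_bigr => a _; rewrite /twist opprB.
have xE : m%:C *: \sum_(j < 2 ^ n) (F j)%:C *: x = x.
  by rewrite -scaler_suml -rmorph_sum scalerA -rmorphM/= Fm scale1r.
rewrite -[X in _ - X]xE -scalerBr -sumrB nrmZr//.
rewrite (le_trans (ler_wpM2l m0 (nrm_sum _ _)))//.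
have Fj j : nrm ((F j)%:C *: g (zeta n ^+ j) x - (F j)%:C *: x) <=
    F j * (e / 2) + c / N%:R.
  rewrite -scalerBr nrmZr//; have [zd|zd] := leP (cabs (zeta n ^+ j - 1)) d.
    rewrite -[leLHS]addr0; apply: lerD; first by rewrite ler_wpM2l// dP.
    by rewrite divr_ge0.
  have Fc : F j <= 4 / (N%:R * d ^+ 2).
    by apply: fejer_kernel_far => //; exact: ltW.
  have gx : nrm (g (zeta n ^+ j) x - x) <= 2 * nrm x.
    by rewrite (le_trans (nrmB _ _))// action_nrm// mulr_natl mulr2n.
  rewrite (le_trans (ler_pM (F0 j) (nrm_ge0 _) Fc gx))// -[leLHS]add0r lerD//.
    by rewrite mulr_ge0// divr_ge0// ltW.
  rewrite le_eqVlt; apply/orP; left; apply/eqP; rewrite /c.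
  by field; rewrite !gt_eqF.
rewrite (le_trans (ler_wpM2l m0 (ler_sum _ (fun (j : 'I__) _ => Fj j))))//.
rewrite big_split/= -mulr_suml mulrDr mulrA Fm mul1r sumr_const card_ord.
rewrite -[c / _ *+ _]mulr_natl [m * _]mulrA /m mulVf ?mul1r; last first.
  by rewrite pnatr_eq0 -lt0n expn_gt0.
by rewrite [leRHS]splitr lerD2l.
Qed.

End CircleAction.

(** * Closed subspaces as Banach spaces *)

(** The closure properties are bundled with the set so that the subtype [csub_type] receives its
    Banach space structure by inference. *)
Record closed_subspace (R : realType) (V : completeNormedModType R[i]) :=
  ClosedSubspace {
    csub_set : set V;
    csub0 : csub_set 0;
    csubP : forall a x y, csub_set x -> csub_set y -> csub_set (a *: x + y);
    csub_closed : closed csub_set }.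

Section ClosedSubspace.
Context {R : realType} {V : completeNormedModType R[i]}.
Variable S : closed_subspace V.

Definition csub_pred : {pred V} := [pred x | `[< csub_set S x >]].

Lemma csub_submod_closed : subsemimod_closed csub_pred.
Proof.
split=> [|a x]; first split => [|x y].
- exact/asboolP/csub0.
- move=> /asboolP Sx /asboolP Sy; apply/asboolP.
  by have := csubP 1 Sx Sy; rewrite scale1r.
- move=> /asboolP Sx; apply/asboolP.
  by have := csubP a Sx (csub0 S); rewrite addr0.
Qed.

HB.instance Definition _ :=
  GRing.isSubmodClosed.Build R[i] V csub_pred csub_submod_closed.

Record csub_type :=
  CSub { csub_val : V; csub_valP : csub_val \in csub_pred }.

HB.instance Definition _ := [isSub for csub_val].
HB.instance Definition _ := [Choice of csub_type by <:].
HB.instance Definition _ := [SubChoice_isSubLmodule of csub_type by <:].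

Implicit Types x y : csub_type.

Definition csub_norm x : R[i] := `|val x|.

Lemma csub_normD x y : csub_norm (x + y) <= csub_norm x + csub_norm y.
Proof. exact: ler_normD. Qed.

Lemma csub_normZ (a : R[i]) x : csub_norm (a *: x) = `|a| * csub_norm x.
Proof. by rewrite /csub_norm linearZ normrZ. Qed.

Lemma csub_norm0_eq0 x : csub_norm x = 0 -> x = 0.
Proof. by move/normr0_eq0 => x0; apply: val_inj. Qed.

HB.instance Definition _ := Lmodule_isNormed.Build R[i] csub_type
  csub_normD csub_normZ csub_norm0_eq0.

Lemma csub_cauchy_cvg (F : set_system csub_type) : ProperFilter F ->
  cauchy F -> cvg F.
Proof.
move=> FF /cauchyP FC; have ballE x y e : ball x e y <-> ball (val x) e (val y).
  by rewrite -!ball_normE.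
have /cauchy_cvgP/cvg_ex[l Fl] : cauchy (fmap (val : csub_type -> V) F).
  apply/cauchy_exP => e e0; have [x Fx] := FC e e0; exists (val x).
  by apply: (@filterS _ F _ _ _ _ Fx) => y xy; apply/ballE.
have Sl : `[< csub_set S l >].
  apply/asboolP; refine (@closed_cvg _ _ F _ val _ (@csub_closed _ _ S) _ _ Fl).
  by apply: nearW => x; apply/asboolP; exact: (csub_valP x).
apply/cvg_ex; exists (CSub Sl); apply/cvg_ballP => e e0.
move/cvg_ballP : Fl => /(_ e e0) Fl; rewrite !near_simpl in Fl *.
by apply: (@filterS _ F _ _ _ _ Fl) => x xl; apply/ballE.
Qed.

HB.instance Definition _ := Uniform_isComplete.Build csub_type csub_cauchy_cvg.

Lemma csub_in x : csub_set S (val x).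
Proof. by apply/asboolP; exact: (csub_valP x). Qed.

Definition csub_mk (x : V) (Sx : csub_set S x) : csub_type :=
  CSub (introT (asboolP _) Sx).

End ClosedSubspace.

(** * The precategory of spectral subspaces *)

Section SpectralSubspaces.
Context {R : realType} {B : cstarAlgType R} {g : R[i] -> B -> B}.
Hypothesis hg : circle_action g.
Implicit Types (x y : B) (k l : int).

Lemma degree0 k : degree g k 0.
Proof. by move=> z z1; rewrite (action0 hg)// scaler0. Qed.

Lemma degreeP k a x y : degree g k x -> degree g k y -> degree g k (a *: x + y).
Proof.
by move=> xk yk z z1; rewrite (actionP hg)// xk// yk// scalerDr !scalerA mulrC.
Qed.

Lemma degreeM k l x y : degree g k x -> degree g l y -> degree g (k + l) (x ** y).
Proof.
move=> xk yl z z1; have [[_ gM _] _] := circle_action_aut hg z1.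
by rewrite gM xk// yl// cmulZl cmulZr scalerA expfzDr// circle_neq0.
Qed.

Lemma degreeS k x : degree g k x -> degree g (- k) (cstar x).
Proof.
move=> xk z z1; have [[_ _ gS] _] := circle_action_aut hg z1.
rewrite gS xk// cstarZ circle_conj; last exact: circleXz.
by rewrite invr_expz.
Qed.

Lemma degree_closed k : closed (degree g k).
Proof.
apply: closed_nrm => x xe z z1; apply/eqP; rewrite -subr_eq0; apply/eqP.
apply: nrm_small => e e0; have [|y yk xy] := xe (e / 2); first exact: divr_gt0.
have -> : g z x - z ^ k *: x = g z (x - y) - z ^ k *: (x - y).
  by rewrite (actionB hg)// yk// scalerBr; abel.
rewrite (le_trans (nrmB _ _))// [e]splitr lerD ?(action_nrm hg)//.
by rewrite nrmZ; have /circleE -> := circleXz k z1; rewrite mul1r.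
Qed.

Definition spectral k : closed_subspace B :=
  ClosedSubspace (degree0 k) (@degreeP k) (@degree_closed k).

Lemma degree0_star_subalgebra : star_subalgebra (degree g 0).
Proof.
split; first exact: degree0.
- by move=> a x y; exact: degreeP.
- by move=> x y x0 y0; rewrite -[0]addr0; exact: degreeM.
- by move=> x x0; rewrite -[0]oppr0; exact: degreeS.
Qed.

Definition shom (n m : nat) : completeNormedModType R[i] :=
  csub_type (spectral (n%:Z - m%:Z)).

Definition hval n m (a : shom n m) : B := csub_val a.

Lemma hvalP n m (a : shom n m) : degree g (n%:Z - m%:Z) (hval a).
Proof. exact: (@csub_in _ _ (spectral _) a). Qed.

Definition smk n m x (xk : degree g (n%:Z - m%:Z) x) : shom n m :=
  csub_mk (S := spectral _) xk.

Lemma hval_inj n m : injective (@hval n m).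
Proof. exact: (@val_inj _ _ (csub_type (spectral (n%:Z - m%:Z)))). Qed.

Lemma scomp_subproof (n m l : nat) (a : shom n m) (b : shom m l) :
  degree g (n%:Z - l%:Z) (hval a ** hval b).
Proof.
have -> : n%:Z - l%:Z = (n%:Z - m%:Z) + (m%:Z - l%:Z) by rewrite addrA subrK.
by apply: degreeM; exact: hvalP.
Qed.

Lemma sstar_subproof n m (a : shom n m) : degree g (m%:Z - n%:Z) (cstar (hval a)).
Proof. by rewrite -opprB; apply: degreeS; exact: hvalP. Qed.

Lemma stens_subproof n m (a : shom n m) : degree g (n.+1%:Z - m.+1%:Z) (hval a).
Proof. by rewrite -!natz -!natr1 opprD addrACA subrr addr0 !natz; exact: hvalP. Qed.


Program Definition spectral_precat : cstar_precat R := @CStarPrecat R shom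
  (fun n m (p : nat) a b => smk (@scomp_subproof n m p a b))
  (fun n m a => smk (@sstar_subproof n m a)) _ _ _ _ _ _ _ _ _.
Next Obligation.
by move=> n m l b a x y; apply: hval_inj; rewrite /= cmulDl cmulZl.
Qed.
Next Obligation.
by move=> n m l b a x y; apply: hval_inj; rewrite /= cmulDr cmulZr.
Qed.
Next Obligation. by move=> *; apply: hval_inj; exact: cmulA. Qed.
Next Obligation. by move=> *; exact: cmul_norm. Qed.
Next Obligation. by move=> *; apply: hval_inj; exact: cstar_antilinear. Qed.
Next Obligation. by move=> *; apply: hval_inj; exact: cstarK. Qed.
Next Obligation. by move=> *; apply: hval_inj; exact: cstarM. Qed.
Next Obligation. by move=> *; exact: cstar_norm. Qed.
Next Obligation.
move=> n m a; have [c [cc c2 cS]] := star_sqrt (hval a).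
(* The last clause of [star_sqrt] applies to the fixed point algebra, which contains a^* a. *)
have c0 : degree g (m%:Z - m%:Z) c.
  rewrite subrr.
  apply: (cS _ degree0_star_subalgebra (@degree_closed 0)).
  by rewrite -(addNr (n%:Z - m%:Z)); apply: degreeM; [apply: degreeS|]; exact: hvalP.
by exists (smk c0); apply: hval_inj; rewrite /= cc.
Qed.

Program Definition spectral_tensor : tensor_precat R :=
  @TensorPrecat R spectral_precat (fun n m a => smk (@stens_subproof n m a)) _ _ _.
Next Obligation. by move=> n m a x y; apply: hval_inj. Qed.
Next Obligation. by move=> *; apply: hval_inj. Qed.
Next Obligation. by move=> *; apply: hval_inj. Qed.

End SpectralSubspaces.

(** * Finite sums of homogeneous elements *)

Section HomogeneousSums.
Context {R : realType} {B : cstarAlgType R} {g : R[i] -> B -> B}.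
Hypothesis hg : circle_action g.
Implicit Types (x y : B) (k l : int) (s : seq (int * B)).

(* Elements of the algebraic direct sum of the spectral subspaces are
   represented by lists of homogeneous elements tagged with a degree. *)
Definition homog s := forall p, p \in s -> degree g p.1 p.2.

Definition hsum s : B := \sum_(p <- s) p.2.

Lemma homog_cons p s : homog (p :: s) <-> degree g p.1 p.2 /\ homog s.
Proof.
split=> [ps|[p1 sh] q]; last by rewrite inE => /predU1P[->|/sh].
split; first by apply: ps; rewrite mem_head.
by move=> q qs; apply: ps; rewrite inE qs orbT.
Qed.

Lemma spec_proj0 k : spec_proj g k 0 = 0.
Proof.
rewrite (spec_proj_eq0 hg (l := k + 1) (degree0 hg _))//.
by rewrite eq_sym -subr_eq0 addrAC subrr add0r.
Qed.

Lemma spec_projD k x y :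
  spec_proj g k (x + y) = spec_proj g k x + spec_proj g k y.
Proof. by have := spec_projP hg k 1 x y; rewrite !scale1r. Qed.

Lemma spec_proj_sum k I (r : seq I) (F : I -> B) :
  spec_proj g k (\sum_(i <- r) F i) = \sum_(i <- r) spec_proj g k (F i).
Proof. exact: (big_morph _ (spec_projD k) (spec_proj0 k)). Qed.

Lemma spec_proj_homog k l x : degree g l x ->
  spec_proj g k x = if l == k then x else 0.
Proof.
move=> xl; case: eqP => [<-|/eqP lk]; first exact: spec_proj_id.
by rewrite (spec_proj_eq0 hg xl)// eq_sym.
Qed.

Lemma spec_proj_hsum k s : homog s ->
  spec_proj g k (hsum s) = \sum_(p <- s | p.1 == k) p.2.
Proof.
move=> sh; rewrite spec_proj_sum [RHS]big_mkcond; apply: eq_big_seq => p ps.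
exact/spec_proj_homog/sh.
Qed.

Lemma hsum_decomp s (r : seq int) : homog s -> uniq r ->
  (forall p, p \in s -> p.1 \in r) ->
  hsum s = \sum_(k <- r) spec_proj g k (hsum s).
Proof.
move=> sh ru sr; under eq_bigr do rewrite spec_proj_hsum//.
rewrite (exchange_big_dep predT)//= /hsum; apply: eq_big_seq => p ps.
rewrite big_mkcond (bigD1_seq p.1) ?sr//= eqxx big1 ?addr0// => k kp.
by rewrite eq_sym (negbTE kp).
Qed.

Definition hspan : set B := [set hsum s | s in homog].

Lemma hspan0 : hspan 0.
Proof. by exists [::] => //; rewrite /hsum big_nil. Qed.

Lemma hspanD x y : hspan x -> hspan y -> hspan (x + y).
Proof.
move=> [s sh <-] [t th <-]; exists (s ++ t); last by rewrite /hsum big_cat.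
by move=> p; rewrite mem_cat => /orP[/sh|/th].
Qed.

Lemma hspan_degree k x : degree g k x -> hspan x.
Proof.
move=> xk; exists [:: (k, x)]; last by rewrite /hsum big_seq1.
by move=> p; rewrite inE => /eqP ->.
Qed.

Lemma hspan_fejer N x : hspan (fejer g N x).
Proof.
rewrite /fejer scaler_sumr.
elim/big_ind: _ => [|y z|a _]; [exact: hspan0|exact: hspanD|].
rewrite scaler_sumr.
elim/big_ind: _ => [|y z|b _]; [exact: hspan0|exact: hspanD|].
apply: (@hspan_degree (a%:Z - b%:Z)); rewrite -[_ *: _]addr0.
by apply: (degreeP hg); [exact: spec_proj_degree|exact: degree0].
Qed.

Lemma closure_hspan : closure hspan = setT.
Proof.
apply/seteqP; split=> // x _; apply/closure_nrmP => e e0.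
have [N xN] := fejer_cvg hg x e0; exists (fejer g N x); first exact: hspan_fejer.
by rewrite nrm_distC.
Qed.

End HomogeneousSums.

Arguments homog {R B} g s.

(** * The Doplicher-Roberts algebra of the spectral precategory *)

Section SpectralDR.
Context {R : realType} {B : cstarAlgType R} {g : R[i] -> B -> B}.
Hypothesis hg : circle_action g.
Implicit Types (x y : B) (k l p : int).

Notation T := (spectral_tensor hg).
Notation E k := (csub_type (spectral hg k)).

Definition tval n m (a : T n m) : B := hval (hg := hg) a.

Lemma tval_tensn d n m (a : T n m) : tval (tensn d a) = tval a.
Proof. by elim: d. Qed.

Lemma tvalP n m (a : T n m) : degree g (n%:Z - m%:Z) (tval a).
Proof. exact: hvalP. Qed.

Definition dval k (x : E k) : B := csub_val x.

Lemma dval_inj k : injective (@dval k).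
Proof. exact: (@val_inj _ _ (E k)). Qed.

Lemma dvalP k (x : E k) : degree g k (dval x).
Proof. exact: (@csub_in _ _ (spectral hg k) x). Qed.

Definition dmk k x (xk : degree g k x) : E k := csub_mk (S := spectral hg k) xk.

Lemma dr_in_subproof k n m (e : n%:Z = m%:Z + k) (a : T n m) : degree g k (tval a).
Proof. by have := tvalP a; rewrite e addrC addKr. Qed.

Lemma dr_mul_subproof k l p (e : p = k + l) (x : E k) (y : E l) :
  degree g p (dval x ** dval y).
Proof. by rewrite e; apply: degreeM => //; exact: dvalP. Qed.

Lemma dr_star_subproof k p (e : p = - k) (x : E k) : degree g p (cstar (dval x)).
Proof. by rewrite e; apply: degreeS => //; exact: dvalP. Qed.

Definition dr_in k n m e a : E k := dmk (@dr_in_subproof k n m e a).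

(** Tensoring does not change the underlying element of B, so the inductive system is constant: the
    limit norm is that of B, and one pair (n, m) already exhausts degree k. *)
Lemma dr_degree k : is_DR_degree (@dr_in k).
Proof.
split.
- by move=> n m e a x y; apply: dval_inj.
- by move=> n m e e' a; apply: dval_inj.
- move=> n m e a; have -> : (fun s => `|tensn s a|) = fun=> `|dr_in e a|.
    by apply/funext => s; rewrite -[LHS]/(`|tval (tensn s a)|) tval_tensn.
  exact: cvg_cst.
- apply/seteqP; split=> // x _; apply: subset_closure.
  have [n [m e]] : exists n m : nat, n%:Z = m%:Z + k.
    case: k x => n _; first by exists n, 0%N; rewrite add0r.
    by exists 0%N, n.+1; rewrite NegzE addrN.
  have xd : degree g (n%:Z - m%:Z) (dval x).
    by rewrite e addrC addKr; exact: dvalP.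
  by exists n, m, e, (smk hg xd); apply: dval_inj.
Qed.

Program Definition spectral_graded : DR_graded T := @DRGraded R T
  (fun k => E k : completeNormedModType R[i]) dr_in
  (fun k l p e u v => dmk (@dr_mul_subproof k l p e u v))
  (fun k p e u => dmk (@dr_star_subproof k p e u)) dr_degree _ _ _ _ _ _ _.
Next Obligation.
by move=> k l p e y a x z; apply: dval_inj; exact: cmul_linearl.
Qed.
Next Obligation.
by move=> k l p e y a x z; apply: dval_inj; exact: cmul_linearr.
Qed.
Next Obligation. by move=> *; exact: cmul_norm. Qed.
Next Obligation. by move=> *; apply: dval_inj. Qed.
Next Obligation. by move=> *; apply: dval_inj; exact: cstar_antilinear. Qed.
Next Obligation.
by move=> k p e x; rewrite !nrmE; congr (_%:C); exact: (nrm_star (dval x)).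
Qed.
Next Obligation. by move=> *; apply: dval_inj. Qed.

Lemma fsum_seq (F : int -> B) (r : seq int) : uniq r ->
  (forall i, i \notin r -> F i = 0) ->
  \sum_(i \in [set: int]) F i = \sum_(i <- r) F i.
Proof.
move=> ru Fr; rewrite (@fsbigE _ _ _ _ _ r)//; last by move=> i _; exact: Fr.
by apply: eq_bigl => i; rewrite in_setT.
Qed.

Lemma spectral_is_DR : is_DR T g.
Proof.
exists spectral_graded, dval; split.
- by [].
- by [].
- by [].
- move=> x xf x0 k; apply: dval_inj.
  have /finite_seqP[r0 rE] := xf; pose r := undup r0.
  have x0r i : i \notin r -> dval (x i) = 0.
    rewrite mem_undup => ir; have [-> //|xi] := eqVneq (x i) 0.
    have : [set k | x k != 0] i by [].
    by rewrite rE /= (negbTE ir).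
  (* The spectral projection isolates the k-th component, which gives independence of the spectral
     subspaces. *)
  have : spec_proj g k (DRsum (G := spectral_graded) dval x) = 0
    by rewrite x0 (spec_proj0 hg).
  rewrite /DRsum (fsum_seq (undup_uniq _) x0r).
  rewrite (spec_proj_sum hg) (eq_bigr (fun i => if i == k then dval (x i) else 0)).
    have [kr|kr _] := boolP (k \in r); last by rewrite x0r.
    rewrite (bigD1_seq k)//= ?eqxx ?undup_uniq// big1 ?addr0// => i ik.
    by rewrite (negbTE ik).
  by move=> i _; rewrite (spec_proj_homog hg k (dvalP (x i))).
- apply/seteqP; split=> // y _.
  have := closure_hspan hg; move/seteqP => [_ /(_ y I)].
  apply: closure_subset => {}y [s sh <-].
  pose x k : spectral_graded k := dmk (spec_proj_degree hg k (hsum s)).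
  pose r := undup [seq q.1 | q <- s].
  have rE i : i \notin r -> spec_proj g i (hsum s) = 0.
    rewrite mem_undup => ir; rewrite (spec_proj_hsum hg)// big1_seq//.
    move=> q /andP[/eqP qi qs].
    by case/negP: ir; rewrite -qi map_f.
  exists x; split.
    apply: (sub_finite_set (B := [set` r])); last exact: finite_seq.
    move=> i /= xi; apply: contraNT xi => ir; apply/eqP; apply: dval_inj.
    exact: rE.
  rewrite /DRsum (fsum_seq (undup_uniq _) rE).
  apply: (hsum_decomp hg) => //; first exact: undup_uniq.
  by move=> q qs; rewrite mem_undup map_f.
- by [].
- by [].
- by move=> z z1 y; rewrite !nrmE (action_nrm hg).
- by move=> z z1 k x; exact: dvalP.
Qed.

End SpectralDR.

(** * Universality *)

Lemma nrm_iter_sqr (R : realType) (A : cstarAlgType R) (x : A) m : cstar x = x ->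
  let y := iter m (fun y => y ** y) x in
  cstar y = y /\ nrm y = nrm x ^+ (2 ^ m).
Proof.
move=> xx; elim: m => [|m [IH1 IH2]] /=; first by rewrite expr1.
by rewrite cstarM IH1 nrm_selfadj_sqr// IH2 -exprM -expnSr.
Qed.

Section Universal.
Context {R : realType} {B : cstarAlgType R} {g : R[i] -> B -> B}.
Hypothesis hg : circle_action g.
Notation T := (spectral_tensor hg).
Notation full := (fun n m => [set: T n m]).

Context {A : cstarAlgType R} (rho : forall n m, T n m -> A).
Hypothesis rho_rep : is_tensor_rep full rho.
Hypothesis rho_cois : coisometric full rho.

Implicit Types (x y : B) (k l : int) (s t : seq (int * B)).

Definition tmk n m x (xk : degree g (n%:Z - m%:Z) x) : T n m := smk hg xk.

Lemma tval_inj n m : injective (@tval R B g hg n m).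
Proof. exact: hval_inj. Qed.

Lemma rho_tensn d n m (a : T n m) : rho (tensn d a) = rho a.
Proof. by elim: d => //= d <-; rewrite -(rho_cois (n := d + n) (m := d + m)). Qed.

(** Pairs with the same difference are linked by iterated tensoring, across which coisometry
    identifies the values of [rho]. *)
Lemma rho_shift n m n' m' (a : T n m) (b : T n' m') :
  n%:Z - m%:Z = n'%:Z - m'%:Z -> tval a = tval b -> rho a = rho b.
Proof.
wlog nn' : n m n' m' a b / (n <= n')%N.
  move=> W; have [nn'|/ltnW nn'] := leqP n n'; first exact: W.
  by move=> e ab; apply/esym/W.
move=> e ab; have [d [dn dm]] : exists d, n' = (d + n)%N /\ m' = (d + m)%N.
  by exists (n' - n)%N; split; lia.
move: b ab; rewrite dn dm => b ab; rewrite -(rho_tensn d a); congr (rho _).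
by apply: tval_inj; rewrite tval_tensn.
Qed.

Definition degree_src k : nat := if k is Posz n then n else 0.
Definition degree_tgt k : nat := if k is Negz n then n.+1 else 0.

Lemma degree_srcB k : (degree_src k)%:Z - (degree_tgt k)%:Z = k.
Proof. by case: k => n /=; rewrite ?subr0// NegzE sub0r. Qed.

(** [rho] read off at a standard pair of objects, (k, 0) or (0, -k). The default value 0 off the
    spectral subspace lets lists of bare elements of B be mapped without carrying proofs of their
    degrees. *)
Definition rep_degree k x : A :=
  match pselect (degree g ((degree_src k)%:Z - (degree_tgt k)%:Z) x) with
  | left xk => rho (tmk xk)
  | right _ => 0
  end.

Lemma rep_degreeE k n m (a : T n m) : n%:Z - m%:Z = k -> rep_degree k (tval a) = rho a.
Proof.
move=> nmk; rewrite /rep_degree; case: pselect => [xk|].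
  by apply: rho_shift => //; rewrite degree_srcB.
by case; rewrite degree_srcB -nmk; exact: tvalP.
Qed.

(** The target m is left free so that a factor can be placed where it composes with the next one. *)
Lemma degree_tval k x (m : nat) : degree g k x -> (`|k| <= m)%N ->
  exists2 a : T (absz (m%:Z + k)%R) m,
    tval a = x & (absz (m%:Z + k))%:Z - m%:Z = k.
Proof.
move=> xk km; have e : (absz (m%:Z + k))%:Z - m%:Z = k by lia.
have xd := xk; rewrite -e in xd.
by exists (tmk xd).
Qed.

Lemma rep_degreeP k a x y : degree g k x -> degree g k y ->
  rep_degree k (a *: x + y) = a *: rep_degree k x + rep_degree k y.
Proof.
move=> xk yk; have [u <- e] := degree_tval xk (leqnn _).
have [v <- _] := degree_tval yk (leqnn _).
have -> : a *: tval u + tval v = tval (a *: u + v) by [].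
by rewrite !rep_degreeE// (rep_linear rho_rep).
Qed.

Lemma rep_degree0 k : rep_degree k 0 = 0.
Proof.
have := rep_degreeP (-1) (degree0 hg k) (degree0 hg k).
by rewrite !scaleN1r oppr0 addr0 addNr.
Qed.

Lemma rep_degreeS k x : degree g k x ->
  rep_degree (- k) (cstar x) = cstar (rep_degree k x).
Proof.
move=> xk; have [u <- e] := degree_tval xk (leqnn _).
rewrite (rep_degreeE u e) -(rep_star rho_rep)// -(@rep_degreeE (- k))//.
by rewrite -opprB e.
Qed.

Lemma rep_degreeM k l x y : degree g k x -> degree g l y ->
  rep_degree (k + l) (x ** y) = rep_degree k x ** rep_degree l y.
Proof.
move=> xk yl; pose m := (`|k| + `|l|)%N.
have [|u <- e] := @degree_tval k x m xk; first exact: leq_addr.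
pose q := absz (m%:Z - l).
have eq : m%:Z - q%:Z = l by lia.
have yd : degree g (m%:Z - q%:Z) y by rewrite eq.
have -> : y = tval (tmk yd) by [].
rewrite (rep_degreeE u e) (rep_degreeE (tmk yd) eq).
rewrite [RHS](rep_mul rho_rep (k := 0) (a := u) (b := tmk yd))//.
by rewrite -(@rep_degreeE (k + l))// -e -eq; lia.
Qed.

(** The C*-identity replaces x by x^* x of degree 0, and on the fixed point algebra [rep_degree 0]
    is a *-homomorphism, hence contractive. *)
Lemma rep_degree_le k x : degree g k x -> nrm (rep_degree k x) <= nrm x.
Proof.
move=> xk; rewrite -ler_sqr ?nnegrE ?nrm_ge0// -!nrm_star_sqr -rep_degreeS//.
rewrite -rep_degreeM//; last exact: degreeS.
rewrite addNr; apply: (star_hom_on_le (degree0_star_subalgebra hg)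
  (@degree_closed _ _ _ hg 0)).
  split=> [a u v u0 v0|u v u0 v0|u u0]; first exact: rep_degreeP.
    by rewrite -rep_degreeM// addr0.
  by rewrite -rep_degreeS// oppr0.
by rewrite -(addNr k); apply: (degreeM hg) => //; exact: degreeS.
Qed.

Definition rep_hsum s : A := \sum_(p <- s) rep_degree p.1 p.2.

(** The right-hand side sees [s] only through its sum, so the value does not depend on how the sum
    is written; it also opens the way to estimates by components. *)
Lemma rep_hsum_decomp s (r : seq int) : homog g s -> uniq r ->
  (forall p, p \in s -> p.1 \in r) ->
  rep_hsum s = \sum_(k <- r) rep_degree k (spec_proj g k (hsum s)).
Proof.
move=> sh ru sr.
have degree_hsum k : rep_degree k (spec_proj g k (hsum s)) =
    \sum_(p <- s) if p.1 == k then rep_degree p.1 p.2 else 0.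
  rewrite (spec_proj_hsum hg)// big_mkcond.
  have : degree g k (\sum_(p <- s) if p.1 == k then p.2 else 0) /\
     rep_degree k (\sum_(p <- s) if p.1 == k then p.2 else 0) =
     \sum_(p <- s) if p.1 == k then rep_degree p.1 p.2 else 0; last by case.
  elim: s sh {sr} => [|p s IH].
    by rewrite !big_nil rep_degree0 => _; split=> //; exact: degree0.
  move=> /homog_cons[pd /IH[sd {}IH]]; rewrite !big_cons.
  case: eqP => [pk|_]; last by rewrite !add0r.
  rewrite -IH -[p.2]scale1r; rewrite pk in pd *.
  by rewrite rep_degreeP// !scale1r; split=> //; rewrite -[p.2]scale1r; exact: degreeP.
under eq_bigr do rewrite degree_hsum.
rewrite exchange_big /rep_hsum /=; apply: eq_big_seq => p ps.
rewrite (bigD1_seq p.1) ?sr//= eqxx big1 ?addr0// => k kp.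
by rewrite eq_sym (negbTE kp).
Qed.

Definition bounded_degree s (N : nat) := forall p, p \in s -> (`|p.1| <= N)%N.

Lemma rep_hsum_le_linear s N : homog g s -> bounded_degree s N ->
  nrm (rep_hsum s) <= (2 * N).+1%:R * nrm (hsum s).
Proof.
move=> sh sN; pose r := [seq i%:Z - N%:Z | i <- iota 0 (2 * N).+1].
rewrite (@rep_hsum_decomp _ r)//.
- rewrite (le_trans (nrm_sum _ _))//.
  rewrite (@le_trans _ _ (\sum_(k <- r) nrm (hsum s)))//.
    apply: ler_sum => k _; rewrite (le_trans (rep_degree_le _))//.
      exact: spec_proj_degree.
    exact: spec_proj_le.
  by rewrite big_const_seq count_predT size_map size_iota iter_addr_0 mulr_natl.
- by rewrite map_inj_uniq ?iota_uniq// => i j; lia.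
- move=> p /sN pN; apply/mapP; exists (absz (p.1 + N%:Z)); last by lia.
  by rewrite mem_iota; lia.
Qed.

(** The *-algebra operations on formal sums. [rep_hsum] respects them list by list, before any
    continuity is known. *)
Definition hlin (a : R[i]) s t := [seq (p.1, a *: p.2) | p <- s] ++ t.
Definition hmul s t := [seq (p.1 + q.1, p.2 ** q.2) | p <- s, q <- t].
Definition hstar s := [seq (- p.1, cstar p.2) | p <- s].

Lemma homog_lin a s t : homog g s -> homog g t -> homog g (hlin a s t).
Proof.
move=> sh th p; rewrite mem_cat => /orP[/mapP[q qs ->]|/th//] /=.
by rewrite -[_ *: _]addr0; apply: (degreeP hg); [exact: sh|exact: degree0].
Qed.

Lemma homog_mul s t : homog g s -> homog g t -> homog g (hmul s t).
Proof.
by move=> sh th p /allpairsP[[q q'] /= [/sh qd /th qd' ->]]; exact: degreeM.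
Qed.

Lemma homog_star s : homog g s -> homog g (hstar s).
Proof. by move=> sh p /mapP[q /sh qd ->]; exact: degreeS. Qed.

Lemma hsum_lin a s t : hsum (hlin a s t) = a *: hsum s + hsum t.
Proof. by rewrite /hsum big_cat big_map scaler_sumr. Qed.

Lemma hsum_mul s t : hsum (hmul s t) = hsum s ** hsum t.
Proof.
rewrite /hsum big_allpairs_dep (big_morph _ (fun x y => cmulDl x y _) (cmul0l _)).
apply: eq_bigr => p _.
by rewrite (big_morph _ (fun x y => cmulDr x y _) (cmul0r _)).
Qed.

Lemma hsum_star s : hsum (hstar s) = cstar (hsum s).
Proof. by rewrite /hsum big_map (big_morph _ cstarD cstar0). Qed.

Lemma rep_hsum_lin a s t : homog g s ->
  rep_hsum (hlin a s t) = a *: rep_hsum s + rep_hsum t.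
Proof.
move=> sh; rewrite /rep_hsum big_cat big_map scaler_sumr; congr (_ + _).
apply: eq_big_seq => p /sh pd /=.
by rewrite -[a *: p.2]addr0 rep_degreeP//; [rewrite rep_degree0 addr0|exact: degree0].
Qed.

Lemma rep_hsum_mul s t : homog g s -> homog g t ->
  rep_hsum (hmul s t) = rep_hsum s ** rep_hsum t.
Proof.
move=> sh th.
rewrite /rep_hsum big_allpairs_dep (big_morph _ (fun u v => cmulDl u v _) (cmul0l _)).
apply: eq_big_seq => p /sh pd.
rewrite (big_morph _ (fun u v => cmulDr u v _) (cmul0r _)).
by apply: eq_big_seq => q /th qd; rewrite rep_degreeM.
Qed.

Lemma rep_hsum_star s : homog g s -> rep_hsum (hstar s) = cstar (rep_hsum s).
Proof.
move=> sh; rewrite /rep_hsum big_map (big_morph _ cstarD cstar0).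
by apply: eq_big_seq => p /sh pd; rewrite rep_degreeS.
Qed.

Lemma bounded_mul s t M N : bounded_degree s M -> bounded_degree t N ->
  bounded_degree (hmul s t) (M + N).
Proof.
move=> sM tN p /allpairsP[[q q'] /= [/sM qM /tN qN ->]] /=.
by move: q.1 q'.1 qM qN => i j; lia.
Qed.

Lemma bounded_degree_ex s : exists N, bounded_degree s N.
Proof.
exists (\sum_(p <- s) `|p.1|)%N => p ps.
by rewrite (big_rem p)//= leq_addr.
Qed.

(* The components of a finite sum are bounded by the sum, so that [rep_hsum]
   has norm at most [2 N + 1] on sums with degrees in [-N, N].  As the degrees
   of the powers of such a sum grow linearly, the factor disappears. *)
Lemma rep_hsum_le s : homog g s -> nrm (rep_hsum s) <= nrm (hsum s).
Proof.
move=> sh; pose h := hmul (hstar s) s.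
have hh : homog g h by apply: homog_mul => //; exact: homog_star.
have hv : hsum h = cstar (hsum s) ** hsum s by rewrite hsum_mul hsum_star.
have ph : rep_hsum h = cstar (rep_hsum s) ** rep_hsum s.
  by rewrite rep_hsum_mul ?rep_hsum_star//; exact: homog_star.
(* [w m] represents the power of h with exponent 2^m; since h is selfadjoint, norms of these powers
   are powers of the norm. *)
pose w m := iter m (fun h => hmul h h) h.
have wh m : homog g (w m) by elim: m => //= m IH; exact: homog_mul.
have wv m : hsum (w m) = iter m (fun y => y ** y) (hsum h).
  by elim: m => //= m <-; rewrite hsum_mul.
have wp m : rep_hsum (w m) = iter m (fun u => u ** u) (rep_hsum h).
  by elim: m => //= m <-; rewrite rep_hsum_mul.
have [N hN] := bounded_degree_ex h.
have wN m : bounded_degree (w m) (2 ^ m * N).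
  elim: m => [|m IH]; first by rewrite mul1n.
  by rewrite expnS -mulnA mul2n -addnn; exact: bounded_mul.
have hs : cstar (hsum h) = hsum h by rewrite hv cstarM cstarK.
have ps : cstar (rep_hsum h) = rep_hsum h by rewrite ph cstarM cstarK.
have key m : nrm (rep_hsum h) ^+ (2 ^ m) <=
    (2 * (2 ^ m * N)).+1%:R * nrm (hsum h) ^+ (2 ^ m).
  have [_ <-] := nrm_iter_sqr m hs; have [_ <-] := nrm_iter_sqr m ps.
  by rewrite -wv -wp; exact: rep_hsum_le_linear.
rewrite -ler_sqr ?nnegrE ?nrm_ge0// -!nrm_star_sqr -ph -hv.
have := nrm_ge0 (hsum h); rewrite le_eqVlt => /predU1P[h0|h0].
  by have := key 0%N; rewrite !expr1 -h0 mulr0.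
rewrite -[leRHS]mul1r -ler_pdivrMr//.
(* Degrees of the power lie in [- 2^m N, 2^m N], so the factor is 1 + 2 N 2^m. *)
apply: (@pow_growth_le1 _ _ 1 (2 * N%:R)) => [|//||m].
- by rewrite divr_ge0// nrm_ge0.
- by rewrite mulr_ge0.
rewrite expr_div_n ler_pdivrMr ?exprn_gt0// (le_trans (key m))//.
rewrite ler_wpM2r ?exprn_ge0 ?nrm_ge0// -natr1 !natrM addrC.
by rewrite [(2 ^ m)%:R * _]mulrC mulrA.
Qed.

(** The graph of the continuous extension of [rep_hsum] to B; [rep_hsum_le] makes it single-valued
    and everywhere defined. *)
Definition rep_limit x (a : A) := exists u : nat -> seq (int * B),
  [/\ forall n, homog g (u n), (fun n => hsum (u n)) @ \oo --> x &
      (fun n => rep_hsum (u n)) @ \oo --> a].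

Lemma rep_limit_ex x : exists a, rep_limit x a.
Proof.
have /choice[u uP] : forall n : nat, exists s,
    homog g s /\ nrm (x - hsum s) <= n.+1%:R^-1.
  move=> n; have := closure_hspan hg; move/seteqP => [_ /(_ x I)].
  move=> /closure_nrmP/(_ (n.+1%:R^-1)); rewrite invr_gt0 ltr0n => /(_ isT).
  by case=> y [s sh <-] xs; exists s.
have ux : (fun n => hsum (u n)) @ \oo --> x.
  apply/cvg_nrmP => e e0; exists (Num.bound e^-1) => n en.
  rewrite nrm_distC; have [_ /le_trans] := uP n; apply.
  rewrite -[e]invrK lef_pV2 ?posrE ?invr_gt0// ltW//.
  apply: (@lt_trans _ _ (Num.bound e^-1)%:R); last by rewrite ltr_nat ltnS.
  by rewrite archi_boundP// invr_ge0 ltW.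
have [|a ua] := @cauchy_nrm_cvg _ A (fun n => rep_hsum (u n)).
  move=> e e0; have /cvg_nrmP/(_ (e / 2))[|N NP] := ux; first exact: divr_gt0.
  exists N => n Nn.
  (* A difference of formal sums is again a formal sum, so the contraction bound applies to it. *)
  have D : rep_hsum (hlin (-1) (u N) (u n)) = rep_hsum (u n) - rep_hsum (u N).
    by rewrite rep_hsum_lin ?scaleN1r 1?addrC//; have [] := uP N.
  rewrite -D (le_trans (rep_hsum_le _))//.
    by apply: homog_lin; [have [] := uP N|have [] := uP n].
  rewrite hsum_lin scaleN1r addrC (le_trans (nrm_dist _ x _))// [e]splitr.
  by rewrite lerD ?NP// nrm_distC NP.
by exists a, u; split=> // n; have [] := uP n.
Qed.

Lemma rep_limit_uniq x a b : rep_limit x a -> rep_limit x b -> a = b.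
Proof.
move=> [u [uh ux ua]] [v [vh vx vb]].
apply/eqP; rewrite -subr_eq0; apply/eqP; apply: nrm_small => e e0.
apply: (@cvg_nrm_le _ _ (fun n => rep_hsum (u n) - rep_hsum (v n))); first exact: cvgB.
have /cvg_nrmP/(_ e e0)[N NP] :
    (fun n => hsum (u n) - hsum (v n)) @ \oo --> x - x by exact: cvgB.
exists N => n /NP; rewrite subrr subr0; apply: le_trans.
have -> : rep_hsum (u n) - rep_hsum (v n) =
    rep_hsum (hlin (-1) (v n) (u n)).
  by rewrite rep_hsum_lin// scaleN1r addrC.
rewrite (le_trans (rep_hsum_le _))//; first exact: homog_lin.
by rewrite hsum_lin scaleN1r addrC.
Qed.

Lemma rep_extends : exists psi : B -> A, star_hom psi /\
  forall n m (a : T n m), psi (tval a) = rho a.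
Proof.
have /choice[psi psiP] := rep_limit_ex.
exists psi; split; first split.
- move=> c x y; apply: (rep_limit_uniq (psiP _)).
  have [u [uh ux ua]] := psiP x; have [v [vh vy vb]] := psiP y.
  exists (fun n => hlin c (u n) (v n)); split.
  + by move=> n; exact: homog_lin.
  + under eq_fun do rewrite hsum_lin.
    by apply: cvgD => //; exact: cvgZl_tmp.
  + under eq_fun do rewrite rep_hsum_lin//.
    by apply: cvgD => //; exact: cvgZl_tmp.
- move=> x y; apply: (rep_limit_uniq (psiP _)).
  have [u [uh ux ua]] := psiP x; have [v [vh vy vb]] := psiP y.
  exists (fun n => hmul (u n) (v n)); split.
  + by move=> n; exact: homog_mul.
  + by under eq_fun do rewrite hsum_mul; exact: cvg_cmul.
  + by under eq_fun do rewrite rep_hsum_mul//; exact: cvg_cmul.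
- move=> x; apply: (rep_limit_uniq (psiP _)).
  have [u [uh ux ua]] := psiP x.
  exists (fun n => hstar (u n)); split.
  + by move=> n; exact: homog_star.
  + by under eq_fun do rewrite hsum_star; exact: cvg_cstar.
  + by under eq_fun do rewrite rep_hsum_star//; exact: cvg_cstar.
- move=> n m a; apply: (rep_limit_uniq (psiP _)).
  exists (fun=> [:: (n%:Z - m%:Z, tval a)]); split.
  + by move=> _ p; rewrite inE => /eqP ->; exact: tvalP.
  + by rewrite /hsum big_seq1; exact: cvg_cst.
  + by rewrite /rep_hsum big_seq1 rep_degreeE//; exact: cvg_cst.
Qed.

End Universal.

(** * The universal algebra for K = J = T *)

Section SpectralOTKJ.
Context {R : realType} {B : cstarAlgType R} {g : R[i] -> B -> B}.
Hypothesis hg : circle_action g.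
Notation T := (spectral_tensor hg).

Lemma full_is_ideal : is_ideal (fun n m => [set: T n m]).
Proof. by split=> // n m; exact: closedT. Qed.

Lemma spectral_is_OTKJ :
  is_OTKJ (fun n m => [set: T n m]) (fun n m => [set: T n m]) g.
Proof.
exists (fun n m a => tval a); split=> //; last first.
  by move=> z z1 n m a _; exact: tvalP.
split.
- split=> // n m k l a b _ _.
  by rewrite [RHS]/(tval (tensn k a) ** tval b) tval_tensn.
- by [].
- move=> S SS Sc XS; apply/seteqP; split=> // x _; apply: Sc.
  have := closure_hspan hg; move/seteqP => [_ /(_ x I)].
  apply: closure_subset => {}x [s sh <-]; rewrite /hsum big_seq.
  elim/big_ind: _ => [|y z|p ps]; first exact: star_subalgebra0.
    exact: star_subalgebraA.
  apply: XS; have [a <- _] := degree_tval hg (sh p ps) (leqnn _).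
  by exists _, _, a.
- move=> A rho hrho crho; have [psi [psih psiE]] := rep_extends hrho crho.
  by exists psi; split=> // n m a _; exact: psiE.
Qed.

End SpectralOTKJ.

Theorem theorem5p3 (R : realType) (B : cstarAlgType R) (gamma : R[i] -> B -> B)
    (hgamma : circle_action gamma) :
  (exists (T : tensor_precat R) (D : cstarAlgType R) (g : R[i] -> D -> D)
      (f : B -> D),
    is_DR T g /\ equivariant_iso gamma g f) /\
  (exists (T : tensor_precat R) (K J : forall n m, set (T n m)),
    [/\ is_ideal K, is_ideal J,
        (forall n m, J n m `<=` Jideal K n m) &
        exists (O : cstarAlgType R) (g : R[i] -> O -> O) (f : B -> O),
          is_OTKJ K J g /\ equivariant_iso gamma g f]).
Proof.
have id_iso : equivariant_iso gamma gamma id.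
  by split=> //; split; [|exists id].
split.
  exists (spectral_tensor hgamma), B, gamma, id.
  by split=> //; exact: spectral_is_DR.
exists (spectral_tensor hgamma), (fun n m => setT), (fun n m => setT).
split; [exact: full_is_ideal|exact: full_is_ideal|by []|].
by exists B, gamma, id; split=> //; exact: spectral_is_OTKJ.
Qed.
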